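(* Let $\alpha\in(\tfrac12,1)$, $s=p^{1-\alpha}$, and $A=\sqrt{2r\log p/n}$ with $r>\alpha$. Assume either $\mathbf X\in\mathrm{SubG}(\sigma^2)$ with $n/p^2\to\infty$, or $\mathbf X\in\mathcal O_n(p)$ with $n\ge p$. Then $$\lim_{p\to\infty}\frac{\log\mathrm{Risk}(s,A)}{s\log p}=-\frac{(r-\alpha)^2}{4r}.$$
   Context: Setting: for each $p$ one observes $(\mathbf y,\mathbf X)$ with $\mathbf y=\mathbf X\boldsymbol\beta+\boldsymbol\varepsilon$, where $\boldsymbol\varepsilon\sim\mathcal N(0,I_n)$, $\mathbf X$ is an $n\times p$ real matrix independent of $\boldsymbol\varepsilon$, $\boldsymbol\beta\in\mathbb R^p$ is unknown, and $n=n(p)\to\infty$ as $p\to\infty$. Design classes: $\mathbf X\in\mathrm{SubG}(\sigma^2)$ means the rows of $\mathbf X$ are i.i.d. centered isotropic ($\mathbb E[xx^T]=I_p$) sub-Gaussian random vectors with sub-Gaussian parameter $\sigma^2$ (for every unit $u$ and $t\in\mathbb R$, $\log\mathbb E e^{t\langle u,x\rangle}\le\sigma^2t^2/2$), and $\mathbf X^T\mathbf X$ is almost surely positive definite; $\mathbf X\in\mathcal O_n(p)$ means $\mathbf X^T\mathbf X=nI_p$. For an integer $s$ and $A>0$, $\Xi(s,A)=\{\boldsymbol\beta\in\mathbb R^p:|\mathrm{supp}(\boldsymbol\beta)|=s,\ |\beta_i|\ge A\text{ for }i\in\mathrm{supp}(\boldsymbol\beta)\}$. A test $T$ is a measurable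 $[0,1]$-valued function of $(\mathbf y,\mathbf X)$; $\mathbb P_{\boldsymbol\beta},\mathbb E_{\boldsymbol\beta}$ denote the law/expectation of $(\mathbf y,\mathbf X)$ (including the randomness of $\mathbf X$) under parameter $\boldsymbol\beta$, and $\mathbb P_0,\mathbb E_0$ those under $\boldsymbol\beta=0$. $\mathrm{Risk}(T,s,A)=\mathbb E_0[T]+\sup_{\boldsymbol\beta\in\Xi(s,A)}\mathbb E_{\boldsymbol\beta}[1-T]$ and $\mathrm{Risk}(s,A)=\inf_T\mathrm{Risk}(T,s,A)$. The sparsity is $s=p^{1-\alpha}$ (rounded to an integer) with $\alpha$ fixed; all limits are as $p\to\infty$. *)

(* Defs.v *)
From HB Require Import structures.
From mathcomp Require Import all_boot all_order all_algebra.
From mathcomp Require Import all_classical all_reals all_analysis.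
Set Implicit Arguments. Unset Strict Implicit. Unset Printing Implicit Defensive.
Import Order.TTheory GRing.Theory Num.Theory.
Import numFieldNormedType.Exports.
Local Open Scope classical_set_scope.
Local Open Scope ring_scope.

Section sparse_detection.
Context {R : realType}.

(* A design matrix X (n x p) is stored as the n-tuple of its rows, each row a
   p-tuple of reals; this carries the product (Borel) sigma-algebra. *)
Definition design (n p : nat) := (n.-tuple (p.-tuple R))%type.
Definition obs (n p : nat) := (n.-tuple R * design n p)%type.

Definition entry {n p} (X : design n p) (i : 'I_n) (j : 'I_p) : R :=
  tnth (tnth X i) j.

Definition mxX {n p} (X : design n p) : 'M[R]_(n, p) :=
  \matrix_(i, j) entry X i j.

Definition XtX {n p} (X : design n p) : 'M[R]_p := (mxX X)^T *m mxX X.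

Definition posdef {p} (M : 'M[R]_p) : Prop :=
  forall v : 'rV[R]_p, v != 0 -> 0 < (v *m M *m v^T) 0 0.

Definition response {n p} (X : design n p) (beta : 'I_p -> R)
  (eps : n.-tuple R) : n.-tuple R :=
  [tuple \sum_(j < p) entry X i j * beta j + tnth eps i | i < n].

(* Expectation of f(eps) for eps ~ N(0, I_n), written as the iterated integral
   over n independent standard normal coordinates. *)
Fixpoint gauss_expect (n : nat) : (n.-tuple R -> \bar R) -> \bar R :=
  match n return (n.-tuple R -> \bar R) -> \bar R with
  | 0 => fun f => f [tuple]
  | m.+1 => fun f =>
      (\int[normal_prob (0:R) 1]_x gauss_expect (fun t => f (cons_tuple x t)))%E
  end.

(* E_beta[T], the expectation over (y, X) where X ~ mu is independent of
   eps ~ N(0, I_n) and y = X beta + eps. *)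
Definition expect_beta {n p} (mu : probability (design n p) R)
  (beta : 'I_p -> R) (T : obs n p -> R) : \bar R :=
  (\int[mu]_X gauss_expect (fun eps => (T (response X beta eps, X))%:E))%E.

Definition is_test {n p} (T : obs n p -> R) : Prop :=
  measurable_fun [set: obs n p] T /\ forall o, 0 <= T o <= 1.

Definition Xi (p s : nat) (A : R) : set ('I_p -> R) :=
  [set beta | #|[pred i : 'I_p | beta i != 0]| = s /\
              forall i, beta i != 0 -> A <= `|beta i| ].



Definition risk_test {n p} (mu : probability (design n p) R) (s : nat) (A : R)
  (T : obs n p -> R) : \bar R :=
  (expect_beta mu (fun=> 0%R) T +
   ereal_sup [set expect_beta mu beta (fun o => (1 - T o)%R) | beta in @Xi p s A])%E.

Definition minimax_risk {n p} (mu : probability (design n p) R) (s : nat)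
  (A : R) : \bar R :=
  ereal_inf [set risk_test mu s A T | T in [set T | @is_test n p T]].

Definition rows_iid {n p} (mu : probability (design n p) R)
  (nu : probability (p.-tuple R) R) : Prop :=
  forall B : 'I_n -> set (p.-tuple R), (forall i, measurable (B i)) ->
    mu [set X : design n p | forall i, B i (tnth X i)] =
    (\prod_(i < n) nu (B i))%E.

Definition centered_isotropic_subG {p} (sigma2 : R)
  (nu : probability (p.-tuple R) R) : Prop :=
  [/\ forall j : 'I_p, (\int[nu]_x (tnth x j)%:E = 0)%E,
      forall j k : 'I_p,
        (\int[nu]_x (tnth x j * tnth x k)%:E = (j == k)%:R%:E)%E &
      forall u : 'I_p -> R, \sum_(j < p) u j ^+ 2 = 1 -> forall t : R,
        (\int[nu]_x (expR (t * \sum_(j < p) u j * tnth x j))%:E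
          <= (expR (sigma2 * t ^+ 2 / 2))%:E)%E ].

Definition sparsity (alpha : R) (p : nat) : nat := Num.truncn (p%:R `^ (1 - alpha)).

Definition amplitude (r : R) (n p : nat) : R := Num.sqrt (2 * r * ln p%:R / n%:R).

End sparse_detection.
Arguments Xi {R} p s A.

(* Main.v *)
(** Put a = sqrt (n) A, so that a^2 = 2 r log p, and kappa = (r + alpha) / (2 r).
    Both bounds use likelihood ratios at the intermediate amplitude kappa A, for which
    kappa^2 r - alpha = r (1 - kappa)^2 = (r - alpha)^2 / (4 r) is the claimed rate, and both
    work on the event that X^T X / n is entrywise delta / s close to the identity.

    Upper bound: reject when a weighted sum, over all sign patterns, of likelihood ratios at
    amplitude kappa A is large. Under the null its mean is explicit for every design; under an
    alternative the Chernoff bound applies to the single term carrying the right signs.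

    Lower bound: put one nonzero coordinate in each of s blocks of size about p^alpha, uniformly
    at random, and let L_t be the likelihood ratio of this mixture at amplitude t. The Bayes risk
    is at least E_0 min (1, L_A), which is an average of expectations of min (1, L_A) / L_(kappa A)
    under Gaussian shifts. By Jensen it suffices to bound the mean of the logarithms of
    L_(kappa A) and 1 / L_A; since L_(kappa A) almost factorises over the blocks, this only takes
    Gaussian exponential moments, and no independence of the coordinates of X^T eps. *)
Require Import Defs.
From HB Require Import structures.
From mathcomp Require Import all_boot all_order all_algebra.
From mathcomp Require Import all_classical all_reals all_analysis.
From mathcomp Require Import measurable_realfun.
From mathcomp Require Import ring lra.
Import Order.TTheory GRing.Theory Num.Theory.
Import numFieldNormedType.Exports.
Set Implicit Arguments. Unset Strict Implicit. Unset Printing Implicit Defensive.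
Local Open Scope classical_set_scope.
Local Open Scope ring_scope.

(** * Gaussian integrals and product measures *)

(** Why this kappa: data that look like amplitude kappa A cost kappa^2 r s log p under the null,
    less the alpha s log p gained from the number of supports, and (1 - kappa)^2 r s log p under the
    alternative. Equating the two exponents gives 2 kappa r = r + alpha. The same value makes log
    L_A vanish to leading order: the term of the true support is (2 kappa - 1) r s log p = alpha s
    log p, which cancels the prior weight, so min (1, L_A) loses nothing at this scale in the lower
    bound. The obstacle is that the limit lives on the exponential scale s log p. In the upper bound
    a bad design must be as unlikely as the error itself, not merely of vanishing probability; in
    the lower bound it is enough that good designs keep a fixed share of the mass. The tolerance
    delta stays fixed as p grows and is chosen only at the end, in terms of the accuracy eps. *)

Section density.
Local Open Scope ereal_scope.
Context d (T : measurableType d) (R : realType).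
Variables (m nu : {measure set T -> \bar R}) (g : T -> R).
Hypotheses (mg : measurable_fun setT g) (g0 : forall x, (0 <= g x)%R).
Hypothesis nuE : forall V, measurable V -> nu V = \int[m]_(x in V) (g x)%:E.

Import HBNNSimple.

Let integral_density_nnsfun (f : {nnsfun T >-> R}) :
  \int[nu]_x (f x)%:E = \int[m]_x ((f x)%:E * (g x)%:E).
Proof.
under eq_integral do rewrite fimfunE -fsumEFin//.
rewrite ge0_integral_fsum//; last 2 first.
  - by move=> r; exact/measurable_EFinP/measurableT_comp.
  - by move=> n x _; rewrite EFinM nnfun_muleindic_ge0.
under [RHS]eq_integral.
  move=> x xD; rewrite fimfunE -fsumEFin// ge0_mule_fsuml; last first.
    by move=> r; rewrite EFinM nnfun_muleindic_ge0.
  over.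
rewrite [RHS]ge0_integral_fsum//; last 2 first.
  - move=> r; apply: emeasurable_funM; last exact/measurable_EFinP.
    by apply/measurable_EFinP; do 2 apply/measurableT_comp => //.
  - move=> n x _; rewrite EFinM mule_ge0//; first by rewrite nnfun_muleindic_ge0.
    by rewrite lee_fin.
apply: eq_fsbigr => r _.
(* The scalar r can be pulled out of the integrals only when it is nonnegative; for r < 0 the level
   set of a nonnegative function is empty. *)
have [r0|r0] := ltP r 0%R.
  have fr0 : f @^-1` [set r] = set0.
    apply/seteqP; split => x //= fxr.
    have : (0 <= f x)%R by exact: fun_ge0.
    by rewrite fxr leNgt r0.
  rewrite fr0 [LHS]integral0_eq ?[RHS]integral0_eq// => x _.
    by rewrite indic0 mulr0 mul0e.
  by rewrite indic0 mulr0.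
under eq_integral do rewrite EFinM.
under [RHS]eq_integral do rewrite EFinM -muleA.
have mI : measurable_fun setT (fun x : T => (\1_(f @^-1` [set r]) x)%:E : \bar R).
  exact/measurable_EFinP/measurable_indic.
have mIg : measurable_fun setT
    (fun x : T => (\1_(f @^-1` [set r]) x)%:E * (g x)%:E).
  by apply: emeasurable_funM => //; exact/measurable_EFinP.
have Ig0 x : setT x -> 0 <= (\1_(f @^-1` [set r]) x)%:E * (g x)%:E.
  by move=> _; rewrite mule_ge0// lee_fin.
rewrite !ge0_integralZl//.
congr (_ * _); rewrite integral_indic// setIT nuE// [LHS]integral_mkcond.
apply: eq_integral => x _; rewrite patchE indicE.
by case: ifPn => _; rewrite ?mul1e ?mul0e.
Qed.

(** On simple functions this is [nuE] applied to level sets; monotone convergence does the rest. *)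
Lemma ge0_integral_density (f : T -> \bar R) :
  measurable_fun setT f -> (forall x, 0 <= f x) ->
  \int[nu]_x f x = \int[m]_x (f x * (g x)%:E).
Proof.
move=> mf f0.
pose f_ := nnsfun_approx measurableT mf.
transitivity (limn (fun n => \int[nu]_x (f_ n x)%:E)).
  rewrite -monotone_convergence//=.
  - apply: eq_integral => ? /[!inE] xD; apply/esym/cvg_lim => //=.
    exact: cvg_nnsfun_approx.
  - by move=> n; exact/measurable_EFinP/measurable_funTS.
  - by move=> n ? _; rewrite lee_fin.
  - by move=> ? _ ? ? mn; rewrite lee_fin; exact/lefP/nd_nnsfun_approx.
have -> : \int[m]_x (f x * (g x)%:E) =
    limn (fun n => \int[m]_x ((f_ n x)%:E * (g x)%:E)).
  rewrite -monotone_convergence//=.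
  - apply: eq_integral => x _; apply/esym/cvg_lim => //.
    apply: cvgeZr => //; exact: cvg_nnsfun_approx.
  - move=> n; apply: emeasurable_funM; last exact/measurable_EFinP.
    exact/measurable_EFinP/measurable_funTS.
  - by move=> n ? _; rewrite mule_ge0// lee_fin.
  - move=> x _ a b ab; rewrite lee_wpmul2r ?lee_fin//.
    exact/lefP/nd_nnsfun_approx.
by apply: congr_lim; apply/funext => n /=; exact: integral_density_nnsfun.
Qed.

End density.

Section gaussian_shift.
Context {R : realType}.
Local Open Scope ereal_scope.
Notation leb := (@lebesgue_measure R).
Notation N01 := (@normal_prob R 0 1).

(** Uniqueness of Lebesgue measure reduces invariance to half-open intervals. *)
Lemma lebesgue_translation (c : R) (V : set R) : measurable V ->
  pushforward leb (fun x : R => (x + c)%R : measurableTypeR R) V = leb V.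
Proof.
move=> mV; apply/esym/lebesgue_measure_unique => //=.
  exact: measurable_funD.
move=> _ mf [[a b]] _ <-; rewrite /pushforward.
have -> : (fun x : R => (x + c)%R : measurableTypeR R) @^-1`
      [set` Interval (BRight a) (BRight b)] =
    [set` Interval (BRight (a - c)%R) (BRight (b - c)%R)].
  by apply/seteqP; split => x/=; rewrite !in_itv/= ltrBlDr lerBrDr.
rewrite !lebesgue_measure_itv/= !lte_fin ltrD2r.
by case: ifPn => // _; rewrite -!EFinB; congr (_%:E); lra.
Qed.

Lemma ge0_integral_translation (c : R) (f : R -> \bar R) :
  measurable_fun setT f -> (forall x, 0 <= f x) ->
  \int[leb]_x f (x + c)%R = \int[leb]_x f x.
Proof.
move=> mf f0.
pose g := fun x : R => (x + c)%R : measurableTypeR R.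
have ms : measurable_fun [set: measurableTypeR R] g by exact: measurable_funD.
transitivity (\int[pushforward leb g]_x f x).
  by rewrite ge0_integral_pushforward.
by apply: eq_measure_integral => V mV _; exact: lebesgue_translation.
Qed.

Lemma ge0_integral_normal (s : R) (f : R -> \bar R) :
  measurable_fun setT f -> (forall x, 0 <= f x) ->
  \int[normal_prob 0 s]_x f x = \int[leb]_x (f x * (normal_pdf 0 s x)%:E).
Proof.
move=> mf f0; apply: ge0_integral_density => //.
- exact: measurable_normal_pdf.
- exact: normal_pdf_ge0.
Qed.

Lemma normal_pdf01 (x : R) :
  normal_pdf 0 1 x = (normal_peak 1 * expR (- x ^+ 2 / 2))%R.
Proof.
rewrite normal_pdfE ?oner_neq0// /normal_fun subr0 expr1n.
by congr (_ * expR (_ / _))%R; rewrite mulr2n.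
Qed.

(** Translating the right side by c completes the square: the weight at x + c times the density at x
    + c is the density at x. *)
Lemma normal_shift (c : R) (f : R -> \bar R) :
  measurable_fun setT f -> (forall x, 0 <= f x) ->
  \int[N01]_x f (x + c)%R = \int[N01]_x (f x * (expR (c * x - c ^+ 2 / 2))%:E).
Proof.
move=> mf f0.
have me : measurable_fun setT (fun x : R => expR (c * x - c ^+ 2 / 2)).
  by apply: measurableT_comp => //; apply: measurable_funB.
have ms : measurable_fun setT (fun x : R => f (x + c)%R).
  by apply: measurableT_comp => //; exact: measurable_funD.
have mfe : measurable_fun setT (fun x => f x * (expR (c * x - c ^+ 2 / 2))%:E).
  by apply: emeasurable_funM => //; exact/measurable_EFinP.
have fe0 x : 0 <= f x * (expR (c * x - c ^+ 2 / 2))%:E.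
  by rewrite mule_ge0// lee_fin expR_ge0.
rewrite !ge0_integral_normal// -[RHS](ge0_integral_translation c); last 2 first.
- by apply: emeasurable_funM => //; apply/measurable_EFinP; exact: measurable_normal_pdf.
- by move=> x; rewrite mule_ge0// lee_fin normal_pdf_ge0.
apply: eq_integral => x _; rewrite -muleA; congr (_ * _).
rewrite -EFinM !normal_pdf01 mulrCA -expRD; congr (_ * expR _)%:E; lra.
Qed.

(** Adding 3/8 turns -x^2 / 2 into -x^2 / 8, the exponent of the centred normal of standard
    deviation 2, whose peak is half as high; hence the value 2. *)
Lemma normal_expR_sqr : \int[N01]_x (expR (3 / 8 * x ^+ 2))%:E = 2%:E.
Proof.
have mexp : measurable_fun setT (fun x : R => expR (3 / 8 * x ^+ 2)).
  apply: measurableT_comp => //; apply: measurable_funM => //.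
rewrite ge0_integral_normal//; last exact/measurable_EFinP.
have two0 : (2 : R)%R != 0%R by rewrite pnatr_eq0.
transitivity (\int[leb]_x (2%:E * (normal_pdf 0 2 x)%:E)).
  apply: eq_integral => x _; rewrite -!EFinM normal_pdf01 normal_pdfE//.
  rewrite mulrCA -expRD /normal_fun subr0 [in RHS]mulrA; congr (_ * expR _)%:E; last first.
    by rewrite -mulr_natr; field.
  rewrite /normal_peak expr1n mul1r.
  rewrite -(mulrnAr _ pi 2) sqrtrM ?sqr_ge0// sqrtr_sqr ger0_norm ?ler0n//.
  by rewrite invfM mulrA divff// mul1r.
have mpdf : measurable_fun setT (fun x : R => (normal_pdf 0 2 x)%:E : \bar R).
  by apply/measurable_EFinP; exact: measurable_normal_pdf.
rewrite ge0_integralZl//; last by move=> x _; rewrite lee_fin normal_pdf_ge0.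
by rewrite integral_normal_pdf mule1.
Qed.

End gaussian_shift.

(** * Laws of i.i.d. tuples *)

Section iid_measure.
Context d (T : measurableType d) (R : realType).
Local Open Scope ereal_scope.

Section product_probability.
Context d' (T' : measurableType d').
Variables (P : probability T R) (Q : probability T' R).

Let product_probability_setT : (P \x Q) setT = 1.
Proof.
rewrite -setXTT product_measure1E//.
by rewrite -[RHS]mule1; congr (_ * _); exact: probability_setT.
Qed.

HB.instance Definition _ :=
  Measure_isProbability.Build _ _ _ (P \x Q) product_probability_setT.

Definition product_probability : probability (T * T')%type R := P \x Q.

End product_probability.

Definition tuple_cons n (z : T * n.-tuple T) : n.+1.-tuple T :=
  cons_tuple z.1 z.2.

Lemma tnth_cons0 n (x : T) (t : n.-tuple T) : tnth (cons_tuple x t) ord0 = x.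
Proof. by []. Qed.

Lemma tnth_cons_lift n (x : T) (t : n.-tuple T) i :
  tnth (cons_tuple x t) (lift ord0 i) = tnth t i.
Proof. by rewrite !(tnth_nth x). Qed.

Lemma measurable_tuple_cons n : measurable_fun setT (@tuple_cons n).
Proof. by apply: measurable_cons. Qed.

HB.instance Definition _ n :=
  isMeasurableFun.Build _ _ _ _ (@tuple_cons n) (@measurable_tuple_cons n).

(** Built by recursion on the head, so that integrals unfold in the same order as in
    [gauss_expect]. *)
Fixpoint iid (nu : probability T R) n : probability (n.-tuple T) R :=
  match n with
  | 0 => \d_([tuple] : 0.-tuple T)
  | m.+1 => distribution (product_probability nu (iid nu m)) (@tuple_cons m)
  end.

Variable nu : probability T R.

Lemma integral_iid0 (f : 0.-tuple T -> \bar R) :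
  measurable_fun setT f -> (forall t, 0 <= f t) ->
  \int[iid nu 0]_t f t = f [tuple].
Proof. by move=> mf f0; rewrite /= integral_dirac// diracT mul1e. Qed.

Lemma integral_iidS n (f : n.+1.-tuple T -> \bar R) :
  measurable_fun setT f -> (forall t, 0 <= f t) ->
  \int[iid nu n.+1]_t f t =
  \int[nu]_x \int[iid nu n]_t f (cons_tuple x t).
Proof.
move=> mf f0; rewrite /= ge0_integral_distribution//.
have mc : measurable_fun setT (f \o @tuple_cons n).
  by apply: measurableT_comp => //; exact: measurable_tuple_cons.
by apply: (fubini_tonelli1 _ mc) => z; exact: f0.
Qed.

Lemma measurable_tuple_box n (B : 'I_n -> set T) : (forall i, measurable (B i)) ->
  measurable [set t : n.-tuple T | forall i, B i (tnth t i)].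
Proof.
move=> mB.
have -> : [set t : n.-tuple T | forall i, B i (tnth t i)] =
    \big[setI/setT]_(i < n) ((fun t : n.-tuple T => tnth t i) @^-1` B i).
  rewrite -bigcap_seq; apply/seteqP; split => t /=.
    by move=> + i _; apply.
  by move=> + i; apply; rewrite /= mem_index_enum.
apply: bigsetI_measurable => i _.
by rewrite -[X in measurable X]setTI; exact: measurable_tnth.
Qed.

Lemma iid_box n (B : 'I_n -> set T) : (forall i, measurable (B i)) ->
  iid nu n [set t | forall i, B i (tnth t i)] = \prod_(i < n) nu (B i).
Proof.
elim: n B => [|n IH] B mB.
  rewrite big_ord0 /= diracE mem_set// => i; by case: i.
rewrite big_ord_recl -(IH (fun i => B (lift ord0 i)))//.
rewrite /= /distribution /pushforward.
have -> : (@tuple_cons n) @^-1` [set t | forall i, B i (tnth t i)] =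
    B ord0 `*` [set t | forall i, B (lift ord0 i) (tnth t i)].
  apply/seteqP; split => -[x t]/=.
    move=> H; split; first exact: (H ord0).
    by move=> i; have := H (lift ord0 i); rewrite /tuple_cons tnth_cons_lift.
  move=> [Bx Bt] i; case: (unliftP ord0 i) => [j ->|->]; last by [].
  by rewrite /tuple_cons tnth_cons_lift; exact: (Bt j).
by rewrite /product_probability product_measure1E//; exact: (@measurable_tuple_box n (fun i => B (lift ord0 i))).
Qed.

(** [rows_iid] prescribes a law on boxes only; boxes are stable under intersection and generate the
    product sigma-algebra, so they determine the law. *)
Lemma iid_unique n (mu : probability (n.-tuple T) R) :
  (forall B : 'I_n -> set T, (forall i, measurable (B i)) ->
    mu [set t | forall i, B i (tnth t i)] = \prod_(i < n) nu (B i)) ->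
  forall A, measurable A -> mu A = iid nu n A.
Proof.
move=> muE A mA.
pose G := [set A : set (n.-tuple T) | exists B : 'I_n -> set T,
  (forall i, measurable (B i)) /\ A = [set t | forall i, B i (tnth t i)]].
have GT : G setT.
  by exists (fun=> setT); split => //; apply/seteqP; split.
apply: (measure_unique G (fun=> setT)) => //.
- apply/seteqP; split.
    apply: sub_sigma_algebra2 => X.
    rewrite -bigcup_seq => -[/= i _ [B mB <-]].
    exists (fun j => if j == i then B else setT); split.
      by move=> j; case: ifPn.
    rewrite setTI; apply/seteqP; split => t /=.
      by move=> Bt j; case: ifPn => // /eqP ->.
    by move=> /(_ i); rewrite eqxx.
  apply: smallest_sub; first exact: sigma_algebra_measurable.
  by move=> _ [B [mB ->]]; exact: measurable_tuple_box.
- move=> _ _ [B [mB ->]] [C [mC ->]]; exists (fun i => B i `&` C i); split.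
    by move=> i; exact: measurableI.
  apply/seteqP; split => t /=; first by move=> [? ?] i; split.
  by move=> H; split => i; have [] := H i.
- by rewrite bigcup_const.
- move=> _ [B [mB ->]]; transitivity (\prod_(i < n) nu (B i)).
    exact: muE.
  by apply/esym; exact: iid_box.
- by move=> _; apply: (@le_lt_trans _ _ 1); rewrite ?probability_le1 ?ltry.
Qed.

Lemma measurable_sum_tnth n (h : T -> R) : measurable_fun setT h ->
  measurable_fun setT (fun t : n.-tuple T => \sum_(i < n) h (tnth t i))%R.
Proof.
move=> mh; apply: measurable_sum => i.
by apply: measurableT_comp => //; exact: measurable_tnth.
Qed.

(** The form in which independence of the rows enters the Chernoff bound for the empirical
    covariance. *)
Lemma iid_expR_sum_le n (h : T -> R) (K : R) : measurable_fun setT h ->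
  \int[nu]_x (expR (h x))%:E <= K%:E ->
  \int[iid nu n]_t (expR (\sum_(i < n) h (tnth t i)))%:E <= (K ^+ n)%:E.
Proof.
move=> mh hK.
have K0 : (0 <= K)%R.
  by rewrite -lee_fin; apply: le_trans hK; apply: integral_ge0 => x _; rewrite lee_fin expR_ge0.
have mS m : measurable_fun setT
    (fun t : m.-tuple T => (expR (\sum_(i < m) h (tnth t i)))%:E).
  by apply/measurable_EFinP/measurableT_comp => //; exact: measurable_sum_tnth.
have meh : measurable_fun setT (fun x => (expR (h x))%:E).
  by apply/measurable_EFinP/measurableT_comp.
elim: n => [|n IH].
  by rewrite integral_iid0// big_ord0 expR0.
rewrite integral_iidS//.
have -> : \int[nu]_x \int[iid nu n]_t
      (expR (\sum_(i < n.+1) h (tnth (cons_tuple x t) i)))%:E =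
    \int[nu]_x ((expR (h x))%:E *
      \int[iid nu n]_t (expR (\sum_(i < n) h (tnth t i)))%:E).
  apply: eq_integral => x _; rewrite -ge0_integralZl//; last exact: mS.
  apply: eq_integral => t _; rewrite -EFinM -expRD big_ord_recl tnth_cons0.
  by under eq_bigr do rewrite tnth_cons_lift.
rewrite exprS EFinM ge0_integralZr//; last first.
  by apply: integral_ge0 => t _; rewrite lee_fin expR_ge0.
by apply: lee_pmul => //; apply: integral_ge0 => t _; rewrite lee_fin expR_ge0.
Qed.

End iid_measure.

Lemma integral_cst_probability d (T : measurableType d) (R : realType)
  (P : probability T R) (c : \bar R) : (\int[P]_x c = c)%E.
Proof.
rewrite integral_cst// -[RHS]mule1; congr (_ * _)%E; exact: probability_setT.
Qed.

(** * Standard Gaussian vectors and the Cameron-Martin formula *)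

Section gaussian_vector.
Context {R : realType}.
Local Open Scope ereal_scope.

(* [normal_prob] lives on [measurableTypeR R], whose display differs from that of [R] itself. *)
Definition of_measurableTypeR (x : measurableTypeR R) : R := x.

Lemma measurable_of_measurableTypeR : measurable_fun setT of_measurableTypeR.
Proof. by move=> _ Y mY; rewrite setTI. Qed.

HB.instance Definition _ :=
  isMeasurableFun.Build _ _ _ _ of_measurableTypeR measurable_of_measurableTypeR.

Definition std_normal : probability R R :=
  distribution (normal_prob 0 1) of_measurableTypeR.

Lemma integral_std_normal (f : R -> \bar R) :
  measurable_fun setT f -> (forall x, 0 <= f x) ->
  \int[std_normal]_x f x = \int[normal_prob 0 1]_x f x.
Proof. by move=> mf f0; rewrite /std_normal ge0_integral_distribution. Qed.

Definition gaussian n : probability (n.-tuple R) R := iid std_normal n.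

Lemma measurable_int_iid d (T : measurableType d) d' (S : measurableType d')
    (Q : probability S R) (f : T * S -> \bar R) :
  measurable_fun setT f -> (forall z, 0 <= f z) ->
  measurable_fun setT (fun x => \int[Q]_y f (x, y)).
Proof. by move=> mf f0; exact: (measurable_fun_fubini_tonelli_F f). Qed.

(** Replaces the iterated integral of the statement by an integral against one probability measure,
    where Fubini and changes of measure are available. *)
Lemma gauss_expectE n (f : n.-tuple R -> \bar R) :
  measurable_fun setT f -> (forall t, 0 <= f t) ->
  gauss_expect f = \int[gaussian n]_t f t.
Proof.
elim: n f => [|n IH] f mf f0; first by rewrite [RHS]integral_iid0.
have mc : measurable_fun setT (f \o @tuple_cons _ R n).
  exact: (measurableT_comp mf (@measurable_tuple_cons _ _ _)).
rewrite [RHS]integral_iidS// integral_std_normal//.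
- apply: eq_integral => x _; rewrite -IH//.
  exact: (measurableT_comp mf (measurableT_comp (@measurable_tuple_cons _ _ _) (pair1_measurable x))).
- by apply: (@measurable_int_iid _ _ _ _ _ (f \o @tuple_cons _ _ n)) => // z; exact: f0.
- by move=> x; exact: integral_ge0.
Qed.

Definition ip n (w : 'I_n -> R) (e : n.-tuple R) : R := (\sum_(i < n) w i * tnth e i)%R.
Definition sqn n (w : 'I_n -> R) : R := (\sum_(i < n) w i ^+ 2)%R.
Definition tshift n (w : 'I_n -> R) (e : n.-tuple R) : n.-tuple R :=
  [tuple w i + tnth e i | i < n]%R.

Lemma measurable_ip n (w : 'I_n -> R) : measurable_fun setT (ip w).
Proof.
apply: measurable_sum => i; apply: measurable_funM => //.
exact: measurable_tnth.
Qed.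

Lemma measurable_tshift n (w : 'I_n -> R) : measurable_fun setT (tshift w).
Proof.
apply/measurable_fun_tnthP => i.
rewrite (_ : _ \o _ = fun e => w i + tnth e i)%R; last first.
  by apply/funext => e; rewrite /= tnth_mktuple.
by apply: measurable_funD => //; exact: measurable_tnth.
Qed.

Lemma measurable_expR_ip n (w : 'I_n -> R) (c : R) :
  measurable_fun setT (fun e : n.-tuple R => expR (ip w e - c)).
Proof.
by apply: measurableT_comp => //; apply: measurable_funB => //; exact: measurable_ip.
Qed.

Lemma tshift_cons n (w : 'I_n.+1 -> R) x (e : n.-tuple R) :
  tshift w (cons_tuple x e) =
  cons_tuple (x + w ord0)%R (tshift (fun i => w (lift ord0 i)) e).
Proof.
apply: eq_from_tnth => i; rewrite tnth_mktuple.
case: (unliftP ord0 i) => [j ->|->]; last by rewrite !tnth_cons0 addrC.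
by rewrite !tnth_cons_lift tnth_mktuple.
Qed.

(** One coordinate at a time: the tail is shifted by the induction hypothesis, the head by
    [normal_shift], and the exponents add up. *)
Lemma cameron_martin n (w : 'I_n -> R) (f : n.-tuple R -> \bar R) :
  measurable_fun setT f -> (forall t, 0 <= f t) ->
  \int[gaussian n]_e f (tshift w e) =
  \int[gaussian n]_e (f e * (expR (ip w e - sqn w / 2))%:E).
Proof.
elim: n w f => [|n IH] w f mf f0.
  rewrite !integral_iid0//.
  - rewrite /ip /sqn !big_ord0 mul0r subrr expR0 mule1; congr f.
    by apply: eq_from_tnth => -[].
  - apply: emeasurable_funM => //.
    by apply/measurable_EFinP; exact: measurable_expR_ip.
  - by move=> t; rewrite mule_ge0// lee_fin expR_ge0.
  - by apply: measurableT_comp => //; exact: measurable_tshift.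
have mfw : measurable_fun setT (fun e => f e * (expR (ip w e - sqn w / 2))%:E).
  apply: emeasurable_funM => //.
  by apply/measurable_EFinP; exact: measurable_expR_ip.
have fw0 t : 0 <= f t * (expR (ip w t - sqn w / 2))%:E.
  by rewrite mule_ge0// lee_fin expR_ge0.
have mfs : measurable_fun setT (fun e => f (tshift w e)).
  by apply: measurableT_comp => //; exact: measurable_tshift.
rewrite [LHS]integral_iidS// [RHS]integral_iidS//.
pose w' i := w (lift ord0 i).
pose g x := \int[gaussian n]_e f (cons_tuple x (tshift w' e)).
have mcons : measurable_fun setT (fun z : R * n.-tuple R => cons_tuple z.1 (tshift w' z.2)).
  apply: measurable_cons => //.
  exact: (measurableT_comp (measurable_tshift w')).
have mg : measurable_fun setT g.
  apply: (@measurable_int_iid _ _ _ _ _ (fun z => f (cons_tuple z.1 (tshift w' z.2)))) => //.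
  exact: measurableT_comp.
have g0 x : 0 <= g x by exact: integral_ge0.
transitivity (\int[std_normal]_x g (x + w ord0)%R).
  by apply: eq_integral => x _; apply: eq_integral => e _; rewrite tshift_cons.
rewrite integral_std_normal//; last first.
  by apply: measurableT_comp => //; exact: measurable_funD.
rewrite normal_shift// -integral_std_normal//; last 2 first.
- apply: emeasurable_funM => //; apply/measurable_EFinP/measurableT_comp => //.
  exact: measurable_funB.
- by move=> x; rewrite mule_ge0// lee_fin expR_ge0.
apply: eq_integral => x _; rewrite /g.
have mfx : measurable_fun setT (fun t : n.-tuple R => f (cons_tuple x t)).
  exact: (measurableT_comp mf (measurableT_comp (@measurable_tuple_cons _ _ _) (pair1_measurable x))).
have mfxe : measurable_fun setT (fun t : n.-tuple R =>
    f (cons_tuple x t) * (expR (ip w' t - sqn w' / 2))%:E).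
  apply: emeasurable_funM => //.
  by apply/measurable_EFinP; exact: measurable_expR_ip.
have fxe0 t : setT t -> 0 <= f (cons_tuple x t) * (expR (ip w' t - sqn w' / 2))%:E.
  by move=> _; rewrite mule_ge0// lee_fin expR_ge0.
rewrite (IH w' (fun t => f (cons_tuple x t)))//.
rewrite -ge0_integralZr//.
apply: eq_integral => t _; rewrite -muleA -EFinM -expRD; congr (_ * (expR _)%:E).
rewrite /ip /sqn !big_ord_recl tnth_cons0.
under [in RHS]eq_bigr do rewrite tnth_cons_lift.
rewrite /w'; lra.
Qed.

(** Case f = 1 of [cameron_martin]: the weight has total mass 1, and its normalising factor is the
    value sought. *)
Lemma gaussian_mgf n (w : 'I_n -> R) :
  \int[gaussian n]_e (expR (ip w e))%:E = (expR (sqn w / 2))%:E.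
Proof.
have := @cameron_martin n w (cst 1) (measurable_cst _) (fun=> lee01).
rewrite integral_cst_probability => h.
have me : measurable_fun setT (fun e => 1 * (expR (ip w e - sqn w / 2))%:E).
  by apply: emeasurable_funM => //; apply/measurable_EFinP; exact: measurable_expR_ip.
have e0 e : setT e -> 0 <= 1 * (expR (ip w e - sqn w / 2))%:E.
  by move=> _; rewrite mul1e lee_fin expR_ge0.
rewrite -[RHS]mule1 h -ge0_integralZl//.
by apply: eq_integral => e _; rewrite mul1e -EFinM -expRD addrCA subrr addr0.
Qed.

Lemma ip_tshift n (v w : 'I_n -> R) e :
  ip v (tshift w e) = (\sum_(i < n) v i * w i + ip v e)%R.
Proof.
by rewrite /ip -big_split/=; apply: eq_bigr => i _; rewrite tnth_mktuple mulrDr.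
Qed.

End gaussian_vector.

(** Integrates the tangent line of exp (- x) at c, written as e^(-D) + e^(-c) D >= e^(-c) (1 + c) so
    that only nonnegative functions are integrated. An upper bound c on the mean suffices. *)
Lemma jensen_expRN {R : realType} d (T : measurableType d) (P : probability T R)
    (D : T -> R) (c : R) :
  measurable_fun setT D -> (forall x, 0 <= D x) ->
  (\int[P]_x (D x)%:E <= c%:E)%E ->
  ((expR (- c))%:E <= \int[P]_x (expR (- D x))%:E)%E.
Proof.
move=> mD D0 Dc.
have c0 : 0 <= c.
  by rewrite -lee_fin; apply: le_trans Dc; apply: integral_ge0 => x _; rewrite lee_fin.
have mexp : measurable_fun setT (fun x => (expR (- D x))%:E).
  apply/measurable_EFinP/measurableT_comp => //; exact: measurableT_comp.
have mD' : measurable_fun setT (fun x => (D x)%:E) by exact/measurable_EFinP.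
have ex0 : (0 <= expR (- c) :> R) by exact: expR_ge0.
have : (\int[P]_x (expR (- c) * (1 + c))%:E <=
    \int[P]_x ((expR (- D x))%:E + (expR (- c))%:E * (D x)%:E))%E.
  apply: ge0_le_integral => //=.
  - by move=> x _; rewrite lee_fin mulr_ge0// addr_ge0.
  - by apply: emeasurable_funD => //; exact: emeasurable_funM.
  - move=> x _; rewrite -EFinM -EFinD lee_fin.
    have -> : expR (- D x) = expR (- c) * expR (c - D x).
      by rewrite -expRD addrA addNr add0r.
    have := ler_wpM2l ex0 (expR_ge1Dx (c - D x)); lra.
rewrite integral_cst_probability ge0_integralD//=; last 2 first.
- by move=> x _; rewrite mule_ge0 ?lee_fin.
- exact: emeasurable_funM.
rewrite ge0_integralZl//; last by move=> x _; rewrite lee_fin.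
move=> H.
have H2 : ((expR (- c))%:E * \int[P]_x (D x)%:E <= (expR (- c) * c)%:E)%E.
  by rewrite EFinM lee_pmul2l// lte_fin expR_gt0.
have := le_trans H (leeD2l _ H2).
by rewrite -leeBlDr// -EFinB mulrDr mulr1 addrK.
Qed.

(** * Fixed designs *)

Section fixed_design.
Context {R : realType}.
Variables n p : nat.
Implicit Types (X : @design R n p) (a b : 'I_p -> R).

Definition lin X b : 'I_n -> R := fun i => \sum_(j < p) entry X i j * b j.

Definition gram X (j k : 'I_p) : R := \sum_(i < n) entry X i j * entry X i k.

(** A quadratic form in a vector with s entries of size 1 accumulates s^2 errors n eta against a
    main term n s. Hence eta = delta / s, which makes the relative error delta. *)
Definition near_isometry (eta : R) : set (@design R n p) :=
  [set X | forall j k, `|gram X j k - n%:R * (j == k)%:R| <= n%:R * eta].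

Lemma responseE X b e : response X b e = tshift (lin X b) e.
Proof. by apply: eq_from_tnth => i; rewrite !tnth_mktuple. Qed.

Lemma lin_dot X a b :
  \sum_(i < n) lin X a i * lin X b i =
  \sum_(j < p) \sum_(k < p) a j * b k * gram X j k.
Proof.
under eq_bigr => i _ do rewrite /lin big_distrlr/=.
rewrite exchange_big/=; apply: eq_bigr => j _.
rewrite exchange_big/=; apply: eq_bigr => k _.
by rewrite /gram mulr_sumr; apply: eq_bigr => i _; ring.
Qed.

(** Controlling the error by l1 norms makes the type II bound uniform over arbitrarily large
    coefficients, since there the main term is also proportional to the l1 norm of [beta]. *)
Lemma near_isometry_dot eta X a b : near_isometry eta X ->
  `|\sum_(i < n) lin X a i * lin X b i - n%:R * \sum_(j < p) a j * b j| <=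
  n%:R * eta * (\sum_(j < p) `|a j|) * (\sum_(j < p) `|b j|).
Proof.
move=> GX; rewrite lin_dot.
have -> : n%:R * \sum_(j < p) a j * b j =
    \sum_(j < p) \sum_(k < p) a j * b k * (n%:R * (j == k)%:R).
  rewrite mulr_sumr; apply: eq_bigr => j _; rewrite (bigD1 j)//= eqxx big1.
    by rewrite mulr1 addr0 mulrC.
  by move=> k kj; rewrite eq_sym (negbTE kj) !mulr0.
rewrite -sumrB; apply: (le_trans (ler_norm_sum _ _ _)).
rewrite -mulrA big_distrlr/= mulr_sumr; apply: ler_sum => j _.
rewrite -sumrB; apply: (le_trans (ler_norm_sum _ _ _)).
rewrite mulr_sumr; apply: ler_sum => k _.
by rewrite -mulrBr !normrM mulrC ler_wpM2r//.
Qed.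

Lemma near_isometry_sqn eta X b : near_isometry eta X ->
  `|sqn (lin X b) - n%:R * \sum_(j < p) b j ^+ 2| <=
  n%:R * eta * (\sum_(j < p) `|b j|) ^+ 2.
Proof.
move=> GX; have := near_isometry_dot b b GX; rewrite -mulrA -expr2.
have -> : sqn (lin X b) = \sum_(i < n) lin X b i * lin X b i.
  by apply: eq_bigr => i _; rewrite expr2.
by have -> : \sum_(j < p) b j ^+ 2 = \sum_(j < p) b j * b j by apply: eq_bigr => j _; rewrite expr2.
Qed.

Lemma measurable_entry (i : 'I_n) (j : 'I_p) :
  measurable_fun setT (fun X : @design R n p => entry X i j).
Proof. exact: (measurableT_comp (measurable_tnth j) (measurable_tnth i)). Qed.

Lemma measurable_lin b (i : 'I_n) :
  measurable_fun setT (fun X : @design R n p => lin X b i).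
Proof.
apply: measurable_sum => j; apply: measurable_funM => //; exact: measurable_entry.
Qed.

Lemma measurable_gram (j k : 'I_p) :
  measurable_fun setT (fun X : @design R n p => gram X j k).
Proof.
apply: measurable_sum => i; apply: measurable_funM; exact: measurable_entry.
Qed.

Lemma measurable_near_isometry eta : measurable (near_isometry eta).
Proof.
have -> : near_isometry eta = \big[setI/setT]_(jk : 'I_p * 'I_p)
    [set X | `|gram X jk.1 jk.2 - n%:R * (jk.1 == jk.2)%:R| <= n%:R * eta].
  rewrite -bigcap_seq; apply/seteqP; split => X /=.
    by move=> GX -[j k] _; exact: GX.
  by move=> GX j k; apply: (GX (j, k)); rewrite /= mem_index_enum.
apply: bigsetI_measurable => -[j k] _ /=.
rewrite -[X in measurable X]setTI.
apply: (@measurable_fun_le _ _ _ setT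
  (fun X => `|gram X j k - n%:R * (j == k)%:R|) (cst (n%:R * eta))) => //.
apply: measurableT_comp => //; apply: measurable_funB => //; exact: measurable_gram.
Qed.

Lemma measurable_response b :
  measurable_fun setT (fun z : @design R n p * n.-tuple R =>
    (response z.1 b z.2, z.1) : obs n p).
Proof.
apply: measurable_fun_pair => //=.
apply/measurable_fun_tnthP => i.
rewrite (_ : _ \o _ = fun z => lin z.1 b i + tnth z.2 i); last first.
  by apply/funext => z; rewrite /= tnth_mktuple.
apply: measurable_funD.
  by apply: (measurableT_comp (measurable_lin b i)).
by apply: (measurableT_comp (measurable_tnth i)).
Qed.

Lemma expect_betaE (mu : probability (design n p) R) b (T : obs n p -> R) :
  measurable_fun setT T -> (forall o, 0 <= T o) ->
  expect_beta mu b T =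
  (\int[mu]_X \int[gaussian n]_e (T (tshift (lin X b) e, X))%:E)%E.
Proof.
move=> mT T0; apply: eq_integral => X _; rewrite gauss_expectE; last 2 first.
- apply/measurable_EFinP.
  exact: (measurableT_comp mT (measurableT_comp (measurable_response b) (pair1_measurable X))).
- by move=> e; rewrite lee_fin.
by apply: eq_integral => e _; rewrite responseE.
Qed.

Lemma measurable_expect_gaussian b (T : obs n p -> R) :
  measurable_fun setT T -> (forall o, 0 <= T o) ->
  measurable_fun setT (fun X : design n p =>
    \int[gaussian n]_e (T (tshift (lin X b) e, X))%:E)%E.
Proof.
move=> mT T0.
apply: (@measurable_int_iid _ _ _ _ _ _ (fun z => (T (tshift (lin z.1 b) z.2, z.1))%:E)).
  apply/measurable_EFinP.
  under eq_fun do rewrite -responseE.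
  exact: (measurableT_comp mT (measurable_response b)).
by move=> z; rewrite lee_fin.
Qed.

End fixed_design.

(** * Upper bound *)

Lemma gaussian_mgf_affine {R : realType} n (w : 'I_n -> R) (c : R) :
  (\int[gaussian n]_e (expR (ip w e + c))%:E = (expR (sqn w / 2 + c))%:E)%E.
Proof.
have mw : measurable_fun setT (fun e : n.-tuple R => (expR (ip w e))%:E).
  by apply/measurable_EFinP/measurableT_comp => //; exact: measurable_ip.
under eq_integral do rewrite expRD mulrC EFinM.
rewrite ge0_integralZl//.
by rewrite gaussian_mgf -EFinM mulrC -expRD.
Qed.

Section scan_test.
Context {R : realType}.
Variables n p : nat.
Variables theta x K : R.
Hypotheses (x0 : 0 <= x) (K0 : 0 <= K).

Definition sgn_val (o : option bool) : R :=
  if o is Some b then (-1) ^+ b else 0.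

Definition sgn_weight (o : option bool) : R := if o is Some _ then x else 1.

Definition pattern (sg : {ffun 'I_p -> option bool}) : 'I_p -> R :=
  fun j => theta * sgn_val (sg j).

(** Likelihood ratio of the coefficient vector [pattern sg] against the null, given the design. *)
Definition tilted (X : @design R n p) (sg : {ffun 'I_p -> option bool}) (y : n.-tuple R) : R :=
  expR (ip (lin X (pattern sg)) y - sqn (lin X (pattern sg)) / 2).

(* The weight x^|supp| makes the sum over all patterns a product over coordinates, which
   avoids counting the supports of size s. *)
Definition scan_stat (o : @obs R n p) : R :=
  \sum_(sg : {ffun 'I_p -> option bool})
    K * \prod_(j < p) sgn_weight (sg j) * tilted o.2 sg o.1.

Definition scan_test (o : @obs R n p) : R := Num.min 1 (scan_stat o).

Lemma sgn_weight_ge0 o : 0 <= sgn_weight o.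
Proof. by case: o => [b|] /=. Qed.

(** Each coordinate contributes independently: 1 if absent, x for either sign. *)
Lemma sum_sgn_weight :
  \sum_(sg : {ffun 'I_p -> option bool}) \prod_(j < p) sgn_weight (sg j) =
  (1 + 2 * x) ^+ p.
Proof.
rewrite -(bigA_distr_bigA (fun _ : 'I_p => sgn_weight))/=.
have -> : \sum_(o : option bool) sgn_weight o = 1 + 2 * x.
  rewrite (bigD1 None)//= (bigD1 (Some true))//= (bigD1 (Some false))//= big1.
    by lra.
  by case=> [[]|].
by rewrite prodr_const card_ord.
Qed.

Lemma scan_stat_term_ge0 X (sg : {ffun 'I_p -> option bool}) (y : n.-tuple R) :
  0 <= K * \prod_(j < p) sgn_weight (sg j) * tilted X sg y.
Proof.
rewrite mulr_ge0 ?expR_ge0// mulr_ge0// prodr_ge0// => j _; exact: sgn_weight_ge0.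
Qed.

Lemma scan_stat_ge0 o : 0 <= scan_stat o.
Proof. by apply: sumr_ge0 => sg _; exact: scan_stat_term_ge0. Qed.

Lemma measurable_tilted (sg : {ffun 'I_p -> option bool}) :
  measurable_fun setT (fun o : @obs R n p => tilted o.2 sg o.1).
Proof.
apply: measurableT_comp => //; apply: measurable_funB.
  apply: measurable_sum => i; apply: measurable_funM.
    exact: (measurableT_comp (measurable_lin (pattern sg) i)).
  exact: (measurableT_comp (measurable_tnth i)).
apply: measurable_funM => //; apply: measurable_sum => i.
apply: measurable_funX; exact: (measurableT_comp (measurable_lin (pattern sg) i)).
Qed.

Lemma scan_test_is_test : is_test scan_test.
Proof.
split; last by move=> o; rewrite le_min ler01 scan_stat_ge0 ge_min lexx.
apply: measurable_minr => //; apply: measurable_sum => sg.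
apply: measurable_funM => //; exact: measurable_tilted.
Qed.

(** Once the minimum with 1 is dropped, every likelihood ratio has null mean 1 whatever the design,
    so only the total weight remains. *)
Lemma scan_type1 (mu : probability (design n p) R) :
  (expect_beta mu (fun=> 0%R) scan_test <= (K * (1 + 2 * x) ^+ p)%:E)%E.
Proof.
have [mT T01] := scan_test_is_test.
have T0 o : 0 <= scan_test o by have /andP[] := T01 o.
rewrite expect_betaE// -[leRHS](integral_cst_probability mu).
have lin0 (X : design n p) (e : n.-tuple R) : tshift (lin X (fun=> 0)) e = e.
  apply: eq_from_tnth => i; rewrite tnth_mktuple /lin big1 ?add0r//.
  by move=> j _; rewrite mulr0.
apply: ge0_le_integral => //.
- by move=> X _; apply: integral_ge0 => e _; rewrite lee_fin.
- exact: measurable_expect_gaussian.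
move=> X _.
have mt (sg : {ffun 'I_p -> option bool}) : measurable_fun setT (fun e : n.-tuple R => (tilted X sg e)%:E).
  by apply/measurable_EFinP; exact: measurable_expR_ip.
have mt' (sg : {ffun 'I_p -> option bool}) : measurable_fun setT (fun e : n.-tuple R =>
    ((K * \prod_(j < p) sgn_weight (sg j))%:E * (tilted X sg e)%:E)%E).
  exact: emeasurable_funM.
apply: (@le_trans _ _ (\int[gaussian n]_e (scan_stat (e, X))%:E)%E).
  apply: ge0_le_integral => //.
  - by move=> e _; rewrite lee_fin.
  - apply/measurable_EFinP.
    under eq_fun do rewrite -responseE.
    exact: (measurableT_comp mT (measurableT_comp (measurable_response (fun=> 0)) (pair1_measurable X))).
  - apply/measurable_EFinP; apply: measurable_sum => sg.
    by apply: measurable_funM => //; apply/measurable_EFinP; exact: mt.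
  - by move=> e _; rewrite lin0 lee_fin ge_min lexx orbT.
under eq_integral do rewrite -sumEFin.
have mt2 (sg : {ffun 'I_p -> option bool}) : measurable_fun setT (fun e : n.-tuple R =>
    (K * \prod_(j < p) sgn_weight (sg j) * tilted X sg e)%:E).
  by under eq_fun do rewrite EFinM; exact: mt'.
rewrite ge0_integral_sum//; last first.
  by move=> sg e _; rewrite lee_fin scan_stat_term_ge0.
rewrite -sum_sgn_weight mulr_sumr -sumEFin.
apply: lee_sum => sg _.
have h : (\int[gaussian n]_e (tilted X sg e)%:E = 1)%E.
  by apply: (etrans (gaussian_mgf_affine _ _)); rewrite subrr expR0.
have w0 : 0 <= K * \prod_(j < p) sgn_weight (sg j).
  by rewrite mulr_ge0// prodr_ge0// => j _; exact: sgn_weight_ge0.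
rewrite le_eqVlt; apply/orP; left; apply/eqP.
rewrite -[RHS]mule1 -h -ge0_integralZl//.
by move=> e _; rewrite lee_fin expR_ge0.
Qed.

Definition sgn_pattern (beta : 'I_p -> R) : {ffun 'I_p -> option bool} :=
  [ffun j => if beta j == 0 then None else Some (beta j < 0)].

Lemma sgn_valP (beta : 'I_p -> R) j : sgn_val (sgn_pattern beta j) * beta j = `|beta j|.
Proof.
rewrite ffunE; case: eqVneq => [->|_]; first by rewrite mulr0 normr0.
by rewrite /=; case: ltP => h; rewrite ?expr1 ?expr0 ?mulN1r ?mul1r ?(ltr0_norm h) ?(ger0_norm h).
Qed.

(** Chernoff's bound in pointwise form. Let u be the factor of [lam]; the term of the true sign
    pattern makes the statistic at least e^(-u). If u < 0 the test equals 1, otherwise the right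
    side is at least 1. *)
Lemma scan_type2_pointwise (X : design n p) (beta : 'I_p -> R) (y : n.-tuple R) (c lam : R) :
  0 <= lam -> K * \prod_(j < p) sgn_weight (sgn_pattern beta j) = expR (- c) ->
  1 - scan_test (y, X) <= expR (lam * (c - ip (lin X (pattern (sgn_pattern beta))) y
     + sqn (lin X (pattern (sgn_pattern beta))) / 2)).
Proof.
move=> lam0 Kc; set w := lin X _.
have S1 : expR (- (c - ip w y + sqn w / 2)) <= scan_stat (y, X).
  rewrite /scan_stat (bigD1 (sgn_pattern beta))//= Kc /tilted -expRD.
  rewrite -/w (_ : - (c - _ + _) = - c + (ip w y - sqn w / 2)); last by ring.
  by rewrite lerDl sumr_ge0// => sg _; exact: scan_stat_term_ge0.
set u := c - ip w y + sqn w / 2 in S1 *.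
have [u0|u0] := leP 0 u.
  apply: (@le_trans _ _ 1).
    by rewrite lerBlDl lerDr le_min ler01 scan_stat_ge0.
  by rewrite -expR0 ler_expR mulr_ge0.
rewrite /scan_test min_l ?subrr ?expR_ge0//.
by apply: le_trans S1; rewrite -expR0 ler_expR oppr_ge0 ltW.
Qed.

End scan_test.

Section scan_risk.
Context {R : realType}.
Variables n p s : nat.
Variables (theta x K A : R).
Hypotheses (theta0 : 0 <= theta) (x0 : 0 <= x) (K0 : 0 <= K).
Notation test := (@scan_test R n p theta x K).

Lemma scan_type2_fixed (X : design n p) (beta : 'I_p -> R) (c lam : R) :
  let w := lin X (pattern theta (sgn_pattern beta)) in
  0 <= lam ->
  K * \prod_(j < p) sgn_weight x (sgn_pattern beta j) = expR (- c) ->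
  (\int[gaussian n]_e (1 - test (tshift (lin X beta) e, X))%:E <=
   (expR (lam * (c - \sum_(i < n) w i * lin X beta i + sqn w / 2)
     + lam ^+ 2 * sqn w / 2))%:E)%E.
Proof.
move=> w lam0 Kc.
have [mT T01] := scan_test_is_test n p theta x0 K0.
(* The noise enters the exponent as - lam <w, e>; its exponential moment produces the term lam^2
   [sqn w] / 2. *)
pose w' i := - lam * w i.
have sqw' : sqn w' = lam ^+ 2 * sqn w.
  by rewrite /sqn mulr_sumr; apply: eq_bigr => i _; rewrite /w' exprMn sqrrN.
have ipw' e : ip w' e = - lam * ip w e.
  by rewrite /ip mulr_sumr; apply: eq_bigr => i _; rewrite /w' mulrA.
rewrite [X in expR X]addrC -sqw' -gaussian_mgf_affine.
apply: ge0_le_integral => //.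
- by move=> e _; rewrite lee_fin subr_ge0; have /andP[] := T01 (tshift (lin X beta) e, X).
- apply/measurable_EFinP; apply: measurable_funB => //.
  under eq_fun do rewrite -responseE.
  exact: (measurableT_comp mT (measurableT_comp (measurable_response beta) (pair1_measurable X))).
- apply/measurable_EFinP/measurableT_comp => //; apply: measurable_funD => //.
  exact: measurable_ip.
move=> e _; rewrite lee_fin.
apply: (le_trans (scan_type2_pointwise theta x0 K0 X (tshift (lin X beta) e) lam0 Kc)).
by rewrite ler_expR -/w ip_tshift ipw'; lra.
Qed.

Lemma sum_norm_sgn_val (beta : 'I_p -> R) :
  \sum_(j < p) `|sgn_val (sgn_pattern beta j) : R| =
  #|[pred i : 'I_p | beta i != 0]|%:R.
Proof.
rewrite -sum1_card natr_sum [RHS]big_mkcond/=; apply: eq_bigr => j _.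
rewrite ffunE inE; case: eqVneq => //= _; first by rewrite normr0.
by rewrite normr_sign.
Qed.

Lemma sgn_val_sqr (o : option bool) : (sgn_val o : R) ^+ 2 = `|sgn_val o|.
Proof. by case: o => [b|] /=; rewrite ?sqrr_sign ?normr_sign ?normr0 ?expr0n. Qed.

Lemma prod_sgn_weight (beta : 'I_p -> R) :
  \prod_(j < p) sgn_weight x (sgn_pattern beta j) =
  x ^+ #|[pred i : 'I_p | beta i != 0]|.
Proof.
rewrite -prodr_const [RHS]big_mkcond/=; apply: eq_bigr => j _.
by rewrite ffunE inE; case: eqVneq.
Qed.

Lemma scan_type2_near_isometry (X : design n p) (beta : 'I_p -> R) (c lam eta : R) :
  near_isometry eta X -> Xi p s A beta ->
  0 <= lam -> 0 <= eta -> eta * s%:R <= 1 ->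
  K * x ^+ s = expR (- c) ->
  (\int[gaussian n]_e (1 - test (tshift (lin X beta) e, X))%:E <=
   (expR (lam * c - lam * theta * n%:R * s%:R * A * (1 - eta * s%:R)
     + (lam + lam ^+ 2) * theta ^+ 2 * n%:R * s%:R * (1 + eta * s%:R) / 2))%:E)%E.
Proof.
move=> GX [card_beta betaA] lam0 eta0 etas Kc.
pose w := lin X (pattern theta (sgn_pattern beta)).
set B := \sum_(j < p) `|beta j|.
have sB : s%:R * A <= B.
  rewrite /B (bigID [pred i | beta i != 0])/= -card_beta -[leLHS]addr0.
  apply: lerD; last exact: sumr_ge0.
  by rewrite mulr_natl -sumr_const; apply: ler_sum => j; exact: betaA.
have sa : \sum_(j < p) `|pattern theta (sgn_pattern beta) j| = theta * s%:R.
  rewrite -card_beta -sum_norm_sgn_val mulr_sumr; apply: eq_bigr => j _.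
  by rewrite normrM ger0_norm.
have sab : \sum_(j < p) pattern theta (sgn_pattern beta) j * beta j = theta * B.
  by rewrite mulr_sumr; apply: eq_bigr => j _; rewrite -mulrA sgn_valP.
have saa : \sum_(j < p) pattern theta (sgn_pattern beta) j ^+ 2 = theta ^+ 2 * s%:R.
  rewrite -card_beta -sum_norm_sgn_val mulr_sumr; apply: eq_bigr => j _.
  by rewrite exprMn sgn_val_sqr.
have := near_isometry_dot (pattern theta (sgn_pattern beta)) beta GX.
have := near_isometry_sqn (pattern theta (sgn_pattern beta)) GX.
rewrite sa sab saa -/w => /ler_normlP[_ V] /ler_normlP[D _].
rewrite -/B in D.
set dot := \sum_(i < n) w i * lin X beta i in D.
apply: (le_trans (scan_type2_fixed X lam0 _)).
  by rewrite prod_sgn_weight card_beta; exact: Kc.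
rewrite lee_fin ler_expR -/w -/dot.
(* The main term and the error both carry the factor theta n B, so the possibly huge B factors out
   before it is replaced by its minimum s A; this uses 1 - eta s >= 0. *)
have D' : theta * n%:R * (s%:R * A) * (1 - eta * s%:R) <= dot.
  apply: (@le_trans _ _ (theta * n%:R * B * (1 - eta * s%:R))).
    by rewrite ler_wpM2r ?subr_ge0// ler_wpM2l// mulr_ge0.
  by move: D; rewrite -/dot; lra.
have V' : sqn w <= theta ^+ 2 * n%:R * s%:R * (1 + eta * s%:R).
  by move: V; lra.
have D2 := ler_wpM2l lam0 D'.
have l2 : 0 <= lam + lam ^+ 2 by rewrite addr_ge0// exprn_ge0.
have V2 := ler_wpM2l l2 V'.
by lra.
Qed.

Lemma minimax_risk_upper (mu : probability (design n p) R) (c lam eta : R) :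
  0 <= lam -> 0 <= eta -> eta * s%:R <= 1 ->
  K * x ^+ s = expR (- c) ->
  (minimax_risk mu s A <= (K * (1 + 2 * x) ^+ p)%:E +
   ((expR (lam * c - lam * theta * n%:R * s%:R * A * (1 - eta * s%:R)
     + (lam + lam ^+ 2) * theta ^+ 2 * n%:R * s%:R * (1 + eta * s%:R) / 2))%:E +
    mu (~` near_isometry eta)))%E.
Proof.
move=> lam0 eta0 etas Kc.
have tT := scan_test_is_test n p theta x0 K0.
have [mT T01] := tT.
have mT' : measurable_fun setT (fun o : obs n p => 1 - test o).
  exact: measurable_funB.
have T'0 o : 0 <= 1 - test o by rewrite subr_ge0; have /andP[] := T01 o.
apply: (@le_trans _ _ (risk_test mu s A test)).
  by apply: ereal_inf_lbound; exists test.
apply: leeD; first exact: scan_type1.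
apply: ge_ereal_sup => _ [beta betaXi <-].
rewrite expect_betaE//.
set E := expR _.
have E0 : 0 <= E by exact: expR_ge0.
have mG := @measurable_near_isometry R n p eta.
have mI : measurable_fun setT (fun X : design n p => (\1_(~` near_isometry eta) X : R)%:E).
  by apply/measurable_EFinP/measurable_indic; exact: measurableC.
rewrite -(integral_cst_probability mu E%:E).
rewrite -[X in (_ + mu X)%E]setIT -integral_indic//; last exact: measurableC.
rewrite -ge0_integralD//.
apply: ge0_le_integral => //.
- by move=> X _; apply: integral_ge0 => e _; rewrite lee_fin.
- exact: (@measurable_expect_gaussian _ _ _ beta (fun o => 1 - test o)).
- exact: emeasurable_funD.
move=> X _; rewrite indicE; have [GX|GX] := pselect (near_isometry eta X).
  rewrite memNset ?adde0; last by apply.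
  exact: scan_type2_near_isometry.
(* On a bad design the type II error is bounded by 1, which the indicator pays for. *)
rewrite mem_set// -(add0e (integral _ _ _)) leeD ?lee_fin//.
rewrite -(integral_cst_probability (gaussian n) 1%:E).
apply: ge0_le_integral => //.
- by move=> e _; rewrite lee_fin.
- apply/measurable_EFinP.
  under eq_fun do rewrite -responseE.
  exact: (measurableT_comp mT' (measurableT_comp (measurable_response beta) (pair1_measurable X))).
by move=> e _; rewrite lee_fin gerBl; have /andP[] := T01 (tshift (lin X beta) e, X).
Qed.

End scan_risk.

(** * Lower bound *)

(** Trades an absolute moment for exponential ones, which are explicit for Gaussians; h is free in
    order to match the standard deviation. *)
Lemma ler_norm_expR {R : realType} (h z : R) : 0 < h ->
  `|z| <= (expR (h * z) + expR (- (h * z))) / h.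
Proof.
move=> h0; rewrite ler_pdivlMr//.
have e1 := expR_ge1Dx (h * z); have e2 := expR_ge1Dx (- (h * z)).
have p1 := expR_ge0 (h * z); have p2 := expR_ge0 (- (h * z)).
by have [z0|z0] := leP 0 z; [rewrite ger0_norm//|rewrite ltr0_norm//]; lra.
Qed.

(** With h = 1 / sqrt W both exponential moments are at most e^(1/2). Only the order sqrt W matters:
    these fluctuations end up negligible against log p per block. *)
Lemma gaussian_norm_ip {R : realType} n (w : 'I_n -> R) (W : R) :
  0 < W -> sqn w <= W ->
  (\int[gaussian n]_e (`|ip w e|)%:E <= (2 * expR (1 / 2) * Num.sqrt W)%:E)%E.
Proof.
move=> W0 wW; set h := (Num.sqrt W)^-1.
have sW0 : 0 < Num.sqrt W by rewrite sqrtr_gt0.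
have h0 : 0 < h by rewrite invr_gt0.
have hW : h ^+ 2 * W = 1.
  by rewrite -[X in _ * X](sqr_sqrtr (ltW W0)) -exprMn mulVf ?gt_eqF// expr1n.
have bnd (t : R) : t ^+ 2 = h ^+ 2 ->
    (\int[gaussian n]_e (expR (t * ip w e))%:E <= (expR (1 / 2))%:E)%E.
  move=> th; pose w' i := t * w i.
  have -> : (\int[gaussian n]_e (expR (t * ip w e))%:E =
      \int[gaussian n]_e (expR (ip w' e))%:E)%E.
    apply: eq_integral => e _; congr (expR _)%:E.
    by rewrite /ip mulr_sumr; apply: eq_bigr => i _; rewrite mulrA.
  rewrite gaussian_mgf lee_fin ler_expR.
  have -> : sqn w' = h ^+ 2 * sqn w.
    by rewrite /sqn mulr_sumr; apply: eq_bigr => i _; rewrite exprMn th.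
  have := ler_wpM2l (sqr_ge0 h) wW; rewrite hW; lra.
have mt (t : R) : measurable_fun setT (fun e : n.-tuple R => (expR (t * ip w e))%:E).
  apply/measurable_EFinP/measurableT_comp => //; apply: measurable_funM => //.
  exact: measurable_ip.
apply: (@le_trans _ _ (\int[gaussian n]_e
   ((h^-1)%:E * ((expR (h * ip w e))%:E + (expR ((- h) * ip w e))%:E)))%E).
  apply: ge0_le_integral => //.
  - by apply/measurable_EFinP/measurableT_comp => //; exact: measurable_ip.
  - by apply: emeasurable_funM => //; exact: emeasurable_funD.
  move=> e _; rewrite -EFinD -EFinM lee_fin mulNr mulrC; exact: ler_norm_expR.
have mDD : measurable_fun setT (fun e : n.-tuple R =>
    (expR (h * ip w e))%:E + (expR ((- h) * ip w e))%:E)%E.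
  exact: emeasurable_funD.
have hi0 : (0 <= (h^-1)%:E)%E by rewrite lee_fin invr_ge0 ltW.
rewrite ge0_integralZl//; last first.
  by move=> e _; rewrite adde_ge0// lee_fin expR_ge0.
rewrite ge0_integralD//.
have := leeD (bnd h erefl) (bnd (- h) (sqrrN h)).
rewrite -EFinD => H.
apply: (le_trans (lee_wpmul2l hi0 H)).
by rewrite -EFinM lee_fin invrK; lra.
Qed.

Section integral_bounds.
Context {R : realType} d (T : measurableType d) (P : probability T R).
Implicit Types F G : T -> R.

(** Carries the side conditions of nonnegative integration along with the bound, so that bounds on
    means compose term by term. *)
Definition mean_le F (a : R) :=
  [/\ measurable_fun setT F, forall x, 0 <= F x & (\int[P]_x (F x)%:E <= a%:E)%E].

Lemma mean_leD F G a b : mean_le F a -> mean_le G b ->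
  mean_le (fun x => F x + G x) (a + b).
Proof.
move=> [mF F0 Fa] [mG G0 Gb]; split.
- exact: measurable_funD.
- by move=> x; rewrite addr_ge0.
- under eq_integral do rewrite EFinD.
  have mF' : measurable_fun setT (fun x => (F x)%:E) by exact/measurable_EFinP.
  have mG' : measurable_fun setT (fun x => (G x)%:E) by exact/measurable_EFinP.
  have F0' x : setT x -> (0 <= (F x)%:E)%E by rewrite lee_fin.
  have G0' x : setT x -> (0 <= (G x)%:E)%E by rewrite lee_fin.
  by rewrite ge0_integralD// EFinD leeD.
Qed.

Lemma mean_le_cst (a : R) : 0 <= a -> mean_le (fun=> a) a.
Proof. by move=> a0; split => //; rewrite integral_cst_probability. Qed.

Lemma mean_leZ F a b : 0 <= b -> mean_le F a -> mean_le (fun x => b * F x) (b * a).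
Proof.
move=> b0 [mF F0 Fa]; split.
- exact: measurable_funM.
- by move=> x; rewrite mulr_ge0.
- under eq_integral do rewrite EFinM.
  have mF' : measurable_fun setT (fun x => (F x)%:E) by exact/measurable_EFinP.
  have F0' x : setT x -> (0 <= (F x)%:E)%E by rewrite lee_fin.
  by rewrite ge0_integralZl// EFinM lee_wpmul2l.
Qed.

Lemma mean_le_sum n (F : 'I_n -> T -> R) (a : R) :
  (forall i, mean_le (F i) a) ->
  mean_le (fun x => \sum_(i < n) F i x) (n%:R * a).
Proof.
elim: n F => [|n IH] F Fa.
  rewrite mul0r (_ : (fun _ => _) = fun=> 0); first exact: mean_le_cst.
  by apply/funext => x; rewrite big_ord0.
rewrite (_ : (fun x => _) = fun x => F ord0 x + \sum_(i < n) F (lift ord0 i) x).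
  rewrite -natr1 mulrDl mul1r [_ + a]addrC; apply: mean_leD => //; exact: IH.
by apply/funext => x; rewrite big_ord_recl.
Qed.

Lemma mean_leW F a b : a <= b -> mean_le F a -> mean_le F b.
Proof. by move=> ab [? ? Fa]; split => //; apply: le_trans Fa _; rewrite lee_fin. Qed.

End integral_bounds.

(** * The block prior on a fixed design *)

Section block_prior.
Context {R : realType}.
Variables n p s m : nat.
Variable idx : 'I_s -> 'I_m -> 'I_p.
Hypothesis idx_inj : forall b k b' k', idx b k = idx b' k' -> b = b' /\ k = k'.
Implicit Types (X : @design R n p) (f : {ffun 'I_s -> 'I_m}).

(** Choosing one coordinate per block, rather than a uniform s-subset, turns a sum over supports
    into a product of s sums. Injectivity of [idx] keeps the blocks disjoint, so the support has
    exactly s elements. *)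
Definition block_set f : {set 'I_p} := finset.imset (fun b => idx b (f b)) (mem 'I_s).

Definition block_ind f : 'I_p -> R := fun j => (j \in block_set f)%:R.

Lemma sum_block_ind f (g : 'I_p -> R) :
  \sum_(j < p) g j * block_ind f j = \sum_(b < s) g (idx b (f b)).
Proof.
transitivity (\sum_(j in block_set f) g j).
  rewrite [RHS]big_mkcond/=; apply: eq_bigr => j _.
  by rewrite /block_ind; case: ifP; rewrite ?mulr1 ?mulr0.
by rewrite finset.big_imset//= => b b' _ _ /idx_inj[].
Qed.

Lemma block_ind_sqr f j : block_ind f j ^+ 2 = block_ind f j.
Proof. by rewrite /block_ind; case: (_ \in _); rewrite ?expr1n ?expr0n. Qed.

Lemma sum1_block_ind f : \sum_(j < p) block_ind f j = s%:R.
Proof.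
have := sum_block_ind f (fun=> 1); rewrite sumr_const card_ord => <-.
by apply: eq_bigr => j _; rewrite mul1r.
Qed.

Lemma block_ind_idx b k f : k != f b -> block_ind f (idx b k) = 0.
Proof.
move=> kf; rewrite /block_ind; case: finset.imsetP => //= -[b' _ /idx_inj[bb' kk']].
by move: kf; rewrite kk' bb' eqxx.
Qed.

Lemma block_ind_Xi f (A : R) : 0 < A -> Xi p s A (fun j => A * block_ind f j).
Proof.
move=> A0; split.
  transitivity #|block_set f|.
    apply: eq_card => j; rewrite inE mulf_eq0 gt_eqF//= /block_ind.
    by case: (j \in block_set f); rewrite ?oner_eq0 ?eqxx.
  rewrite /block_set finset.card_imset ?card_ord// => b b' /idx_inj[]//.
move=> j; rewrite mulf_eq0 gt_eqF//= /block_ind.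
by case: (j \in _); rewrite ?eqxx// mulr1 ger0_norm// ltW.
Qed.

Lemma sum_norm_block_ind f : \sum_(j < p) `|block_ind f j| = s%:R.
Proof.
by rewrite -(sum1_block_ind f); apply: eq_bigr => j _; rewrite ger0_norm.
Qed.

Lemma sum_sqr_block_ind f : \sum_(j < p) block_ind f j ^+ 2 = s%:R.
Proof.
by rewrite -(sum1_block_ind f); apply: eq_bigr => j _; rewrite block_ind_sqr.
Qed.

Section fixed_design_lower.
Variables (X : @design R n p) (eta : R).
Hypotheses (GX : near_isometry eta X) (s0 : (0 < s)%N) (eta0 : 0 <= eta).
Let delta := eta * s%:R.

Definition block_sum f : 'I_n -> R := fun i => \sum_(b < s) entry X i (idx b (f b)).
Definition xcol (j : 'I_p) : 'I_n -> R := fun i => entry X i j.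

Lemma lin_block_ind f (t : R) i :
  lin X (fun j => t * block_ind f j) i = t * block_sum f i.
Proof.
rewrite /block_sum -(sum_block_ind f (fun j => entry X i j)) mulr_sumr.
by apply: eq_bigr => j _; ring.
Qed.

Lemma lin_block_ind1 f i : lin X (block_ind f) i = block_sum f i.
Proof. by rewrite /block_sum -(sum_block_ind f (fun j => entry X i j)). Qed.

Lemma ip_block_sum f e : ip (block_sum f) e = \sum_(b < s) ip (xcol (idx b (f b))) e.
Proof.
by rewrite exchange_big/=; apply: eq_bigr => i _; rewrite mulr_suml.
Qed.

Lemma sqn_block_sum f :
  `|sqn (block_sum f) - n%:R * s%:R| <= n%:R * s%:R * delta.
Proof.
have := near_isometry_sqn (block_ind f) GX.
have -> : sqn (lin X (block_ind f)) = sqn (block_sum f).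
  by apply: eq_bigr => i _; rewrite lin_block_ind1.
by rewrite sum_norm_block_ind sum_sqr_block_ind => /le_trans; apply; rewrite /delta; lra.
Qed.

Lemma lin_delta j i : lin X (fun k => (k == j)%:R) i = xcol j i.
Proof.
rewrite /lin (bigD1 j)//= eqxx mulr1 big1 ?addr0// => k /negbTE ->.
by rewrite mulr0.
Qed.

Lemma sum_delta (j : 'I_p) (g : 'I_p -> R) : \sum_(k < p) (k == j)%:R * g k = g j.
Proof.
rewrite (bigD1 j)//= eqxx mul1r big1 ?addr0// => k /negbTE ->.
by rewrite mul0r.
Qed.

Lemma sum_norm_delta (j : 'I_p) : \sum_(k < p) `|(k == j)%:R : R| = 1.
Proof.
rewrite -[RHS](sum_delta j (fun=> 1)); apply: eq_bigr => k _.
by rewrite mulr1 normr_nat.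
Qed.

(** Column j sees the selected set only through its own membership, up to s entrywise errors n eta,
    which add up to n delta. *)
Lemma dot_xcol_block_sum j f :
  \sum_(i < n) xcol j i * block_sum f i <= n%:R * (block_ind f j + delta).
Proof.
have := near_isometry_dot (fun k => (k == j)%:R) (block_ind f) GX.
rewrite sum_delta sum_norm_delta mulr1.
rewrite sum_norm_block_ind.
under eq_bigr do rewrite lin_delta lin_block_ind1.
by move=> /ler_normlP[_]; rewrite /delta; lra.
Qed.

Lemma sqn_xcol j : sqn (xcol j) <= n%:R * (1 + delta).
Proof.
have := near_isometry_sqn (fun k => (k == j)%:R) GX.
rewrite sum_norm_delta expr1n mulr1.
have -> : \sum_(k < p) ((k == j)%:R : R) ^+ 2 = 1.
  rewrite -[RHS](sum_delta j (fun=> 1)); apply: eq_bigr => k _.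
  by case: (k == j); rewrite ?mulr1 ?expr1n ?expr0n.
have -> : sqn (lin X (fun k => (k == j)%:R)) = sqn (xcol j).
  by apply: eq_bigr => i _; rewrite lin_delta.
move=> /ler_normlP[_]; have : eta <= delta.
  by rewrite /delta ler_peMr// ler1n.
by move=> /(ler_wpM2l (ler0n R n)); lra.
Qed.

Section tilts.
Variables (A kappa c1 c2 : R).
Let theta := kappa * A.
Hypotheses (m0 : (0 < m)%N) (A0 : 0 < A) (kappa_half : 1 / 2 <= kappa).
(** Under the shift by [theta * block_sum f], [c1] dominates the deterministic part of - log L_A,
    computed from the term f alone, and [c2] that of log L_theta per block, computed from the
    selected coordinate: theta^2 n (1 + delta) from the shift, minus theta^2 n (1 - delta) / 2 from
    the normalisation, minus log m from the prior. *)
Hypothesis c1_ge : s%:R * ln m%:R -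
  A ^+ 2 * n%:R * s%:R * (1 - delta) * (kappa - 1 / 2) <= c1.
Hypotheses (c2_ge0 : 0 <= c2)
  (c2_ge : theta ^+ 2 * n%:R * (1 / 2 + 3 / 2 * delta) - ln m%:R <= c2).

Definition tilt (t : R) f (y : n.-tuple R) : R :=
  expR (t * ip (block_sum f) y - t ^+ 2 * sqn (block_sum f) / 2).

(** The likelihood ratio L_t of the uniform prior on the m^s supports; t stays free because both t =
    A and t = theta are used. *)
Definition mixture (t : R) (y : n.-tuple R) : R :=
  (m%:R ^+ s)^-1 * \sum_(f : {ffun 'I_s -> 'I_m}) tilt t f y.

Definition shifted f (e : n.-tuple R) := tshift (fun i => theta * block_sum f i) e.

Let lnm : expR (ln m%:R : R) = m%:R.
Proof. by rewrite lnK// posrE ltr0n. Qed.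

Let theta0 : 0 <= theta.
Proof. apply: mulr_ge0; last exact: ltW. by apply: le_trans kappa_half; rewrite divr_ge0. Qed.

Let nat_m0 : (0 : R) < m%:R. Proof. by rewrite ltr0n. Qed.

Let delta0 : 0 <= delta. Proof. by rewrite mulr_ge0. Qed.

(** Of the m^s terms only that of the true f is kept. Its prior price s log m is offset by the drift
    (kappa - 1/2) A^2 n s, up to delta. *)
Lemma mixture_ge f e :
  expR (- (c1 + `|A * ip (block_sum f) e|)) <= mixture A (shifted f e).
Proof.
have tf : (m%:R ^+ s)^-1 * tilt A f (shifted f e) <= mixture A (shifted f e).
  rewrite /mixture ler_wpM2l ?invr_ge0 ?exprn_ge0// (bigD1 f)//= lerDl.
  by apply: sumr_ge0 => g _; exact: expR_ge0.
apply: le_trans tf.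
rewrite -lnm -expRM_natl -expRN -expRD ler_expR /shifted ip_tshift.
have -> : \sum_(i < n) block_sum f i * (theta * block_sum f i) =
    theta * sqn (block_sum f).
  by rewrite /sqn mulr_sumr; apply: eq_bigr => i _; ring.
have /ler_normlP[V _] := sqn_block_sum f.
have V' : n%:R * s%:R * (1 - delta) <= sqn (block_sum f) by move: V; lra.
have c0 : 0 <= A ^+ 2 * (kappa - 1 / 2) by rewrite mulr_ge0 ?sqr_ge0 ?subr_ge0.
have := ler_wpM2l c0 V'.
have : - `|A * ip (block_sum f) e| <= A * ip (block_sum f) e.
  by have := lerNnormlW (lexx `|A * ip (block_sum f) e|).
rewrite /theta; move: c1_ge; lra.
Qed.

(** Contribution of the unselected coordinates of a block, averaged over the whole block. The offset
    3/2 delta is delta from [dot_xcol_block_sum] plus delta / 2 from the normalisation; the mean is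
    then at most exp (2 delta theta^2 n), the factor divided out in [mixture_exponent]. *)
Definition noise_avg (b : 'I_s) (e : n.-tuple R) : R :=
  m%:R^-1 * \sum_(k < m) expR (3 / 2 * theta ^+ 2 * n%:R * delta -
    theta ^+ 2 * n%:R / 2 + theta * ip (xcol (idx b k)) e).

Definition mixture_exponent f (e : n.-tuple R) : R :=
  \sum_(b < s) (c2 + 2 * delta * theta ^+ 2 * n%:R +
    `|theta * ip (xcol (idx b (f b))) e| +
    noise_avg b e * expR (- (2 * delta * theta ^+ 2 * n%:R))).

(** Linearises the logarithm of a block average. With D = 2 delta theta^2 n and q the noise divided
    by e^D, the signal plus e^D q is at most signal * e^D * (1 + q), and 1 + q <= e^q. The resulting
    exponent is linear in the noise, so its mean requires only exponential moments. *)
Let block_bound f b e :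
  m%:R^-1 * \sum_(k < m) expR (theta * ip (xcol (idx b k)) (shifted f e) -
     theta ^+ 2 * n%:R * (1 - delta) / 2) <=
  expR (c2 + 2 * delta * theta ^+ 2 * n%:R +
    `|theta * ip (xcol (idx b (f b))) e| +
    noise_avg b e * expR (- (2 * delta * theta ^+ 2 * n%:R))).
Proof.
have ipE k : theta * ip (xcol (idx b k)) (shifted f e) <=
    theta ^+ 2 * n%:R * (block_ind f (idx b k) + delta) +
    theta * ip (xcol (idx b k)) e.
  rewrite /shifted ip_tshift mulrDr lerD2r.
  have -> : \sum_(i < n) xcol (idx b k) i * (theta * block_sum f i) =
      theta * \sum_(i < n) xcol (idx b k) i * block_sum f i.
    by rewrite mulr_sumr; apply: eq_bigr => i _; ring.
  have := ler_wpM2l (sqr_ge0 theta) (dot_xcol_block_sum (idx b k) f).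
  by rewrite expr2; lra.
set D := 2 * delta * theta ^+ 2 * n%:R.
have D0 : 0 <= D.
  by rewrite /D mulr_ge0 ?ler0n// mulr_ge0 ?sqr_ge0// mulr_ge0 ?ler0n.
set z := `|theta * ip (xcol (idx b (f b))) e|.
have noise0 : 0 <= noise_avg b e.
  rewrite mulr_ge0 ?invr_ge0 ?ler0n// sumr_ge0// => k _; exact: expR_ge0.
have step1 : m%:R^-1 * \sum_(k < m) expR (theta * ip (xcol (idx b k)) (shifted f e) -
     theta ^+ 2 * n%:R * (1 - delta) / 2) <= expR (c2 + z) + noise_avg b e.
  rewrite (bigD1 (f b))//= mulrDr; apply: lerD.
    rewrite -[X in X^-1]lnm -expRN -expRD ler_expR.
    have := ipE (f b).
    have : block_ind f (idx b (f b)) <= 1 by rewrite /block_ind lern1 leq_b1.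
    move=> /(ler_wpM2l (_ : 0 <= theta ^+ 2 * n%:R)).
    rewrite mulr_ge0 ?sqr_ge0// => /(_ isT).
    have := ler_norm (theta * ip (xcol (idx b (f b))) e).
    rewrite -/z; move: c2_ge; lra.
  (* The noise average also contains the selected index, whose extra term is nonnegative. *)
  rewrite ler_wpM2l ?invr_ge0 ?ler0n// [leRHS](bigD1 (f b))//= -[leLHS]add0r.
  apply: lerD; first exact: expR_ge0.
  apply: ler_sum => k kf; rewrite ler_expR.
  by have := ipE k; rewrite block_ind_idx//; lra.
apply: (le_trans step1).
set q := noise_avg b e * expR (- D).
have qE : noise_avg b e = expR D * q by rewrite /q mulrCA -expRD subrr expR0 mulr1.
have -> : expR (c2 + D + z + q) = expR (c2 + z) * expR D * expR q.
  by rewrite -!expRD; congr expR; ring.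
have q0 : 0 <= q by rewrite mulr_ge0 ?expR_ge0.
have e1 : 1 <= expR (c2 + z) by rewrite -expR0 ler_expR addr_ge0// normr_ge0.
have e2 : 1 <= expR D by rewrite -expR0 ler_expR.
have e3 := expR_ge1Dx q.
rewrite qE.
have h1 : expR (c2 + z) * expR D * (1 + q) <= expR (c2 + z) * expR D * expR q.
  by rewrite ler_wpM2l// mulr_ge0 ?expR_ge0.
apply: le_trans h1.
rewrite mulrDr mulr1; apply: lerD; first by rewrite ler_peMr// expR_ge0.
by rewrite -mulrA ler_peMl// mulr_ge0// expR_ge0.
Qed.

(** Blocks are coupled in a tilt only through [sqn (block_sum g)]. Replacing it by its lower bound n
    s (1 - delta) makes each tilt a product over blocks, and the sum over g becomes a product of
    block averages. *)
Lemma mixture_le f e : mixture theta (shifted f e) <= expR (mixture_exponent f e).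
Proof.
have expR_sum (I : finType) (F : I -> R) : expR (\sum_i F i) = \prod_i expR (F i).
  by apply: (big_morph expR (@expRD R) (@expR0 R)).
rewrite /mixture /mixture_exponent expR_sum.
have -> : (m%:R ^+ s)^-1 = \prod_(b < s) (m%:R^-1 : R).
  by rewrite prodr_const card_ord exprVn.
apply: (@le_trans _ _ (\prod_(b < s) (m%:R^-1 *
   \sum_(k < m) expR (theta * ip (xcol (idx b k)) (shifted f e) -
     theta ^+ 2 * n%:R * (1 - delta) / 2)))); last first.
  apply: ler_prod => b _; rewrite block_bound andbT.
  by rewrite mulr_ge0 ?invr_ge0 ?ler0n// sumr_ge0// => k _; exact: expR_ge0.
rewrite big_split/=; apply: ler_wpM2l.
  by apply: prodr_ge0 => b _; rewrite invr_ge0 ler0n.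
rewrite (bigA_distr_bigA (fun b k => expR (theta * ip (xcol (idx b k)) (shifted f e) -
     theta ^+ 2 * n%:R * (1 - delta) / 2)))/=.
apply: ler_sum => g _.
rewrite -expR_sum ler_expR sumrB -mulr_sumr -ip_block_sum sumr_const card_ord.
have /ler_normlP[V _] := sqn_block_sum g.
have V' : n%:R * s%:R * (1 - delta) <= sqn (block_sum g) by move: V; lra.
have := ler_wpM2l (sqr_ge0 theta) V'; rewrite -mulr_natr; lra.
Qed.

Let abs_mean (W : R) := 2 * expR (1 / 2) * Num.sqrt W.
Let W1 := A ^+ 2 * (n%:R * s%:R * (1 + delta)).
Let W2 := theta ^+ 2 * (n%:R * (1 + delta)).

Definition fixed_exponent : R :=
  c1 + abs_mean W1 + s%:R * (c2 + 2 * delta * theta ^+ 2 * n%:R + abs_mean W2 + 1).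

Hypotheses (n0 : (0 < n)%N) (c1_ge0 : 0 <= c1).

Let theta_gt0 : 0 < theta.
Proof. by rewrite mulr_gt0//; apply: lt_le_trans kappa_half; rewrite divr_gt0. Qed.

Let sqnZ (t : R) (w : 'I_n -> R) : sqn (fun i => t * w i) = t ^+ 2 * sqn w.
Proof. by rewrite /sqn mulr_sumr; apply: eq_bigr => i _; rewrite exprMn. Qed.

Let ipZ (t : R) (w : 'I_n -> R) e : ip (fun i => t * w i) e = t * ip w e.
Proof. by rewrite /ip mulr_sumr; apply: eq_bigr => i _; rewrite mulrA. Qed.

Let mean_le_abs (t : R) (w : 'I_n -> R) W : 0 < W -> t ^+ 2 * sqn w <= W ->
  mean_le (gaussian n) (fun e => `|t * ip w e|) (abs_mean W).
Proof.
move=> W0 wW; split => //.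
- apply: measurableT_comp => //; apply: measurable_funM => //; exact: measurable_ip.
- under eq_integral do rewrite -ipZ.
  by apply: gaussian_norm_ip => //; rewrite sqnZ.
Qed.

Lemma mean_le_noise_avg b :
  mean_le (gaussian n) (fun e => noise_avg b e * expR (- (2 * delta * theta ^+ 2 * n%:R))) 1.
Proof.
rewrite (_ : (fun e => _) = fun e => \sum_(k < m) (m%:R^-1 *
   expR (ip (fun i => theta * xcol (idx b k) i) e + (3 / 2 * theta ^+ 2 * n%:R * delta -
    theta ^+ 2 * n%:R / 2 - 2 * delta * theta ^+ 2 * n%:R)))); last first.
  apply/funext => e; rewrite /noise_avg -[LHS]mulrA mulr_suml mulr_sumr.
  by apply: eq_bigr => k _; rewrite -expRD ipZ; congr (_ * expR _); ring.
apply: (@mean_leW _ _ _ _ _ (m%:R * (m%:R^-1 * 1))).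
  by rewrite mulr1 mulfV// gt_eqF.
apply: mean_le_sum => k; apply: mean_leZ; first by rewrite invr_ge0 ler0n.
split.
- apply: measurableT_comp => //; apply: measurable_funD => //; exact: measurable_ip.
- by move=> e; exact: expR_ge0.
rewrite gaussian_mgf_affine lee_fin -[leRHS]expR0 ler_expR sqnZ.
(* The coefficients of theta^2 n cancel: (1 + delta) / 2 + 3 delta / 2 - 1 / 2 - 2 delta = 0. *)
have := ler_wpM2l (sqr_ge0 theta) (sqn_xcol (idx b k)); lra.
Qed.

(** Dominates log (L_theta / min (1, L_A)) at the shifted point. The part bounding - log L_A is
    nonnegative, so the case where the minimum is 1 is covered too. *)
Definition total_exponent f (e : n.-tuple R) : R :=
  c1 + `|A * ip (block_sum f) e| + mixture_exponent f e.

Lemma mean_le_total_exponent f :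
  mean_le (gaussian n) (total_exponent f) fixed_exponent.
Proof.
have nR : (0 : R) < n%:R by rewrite ltr0n.
have sR : (0 : R) < s%:R by rewrite ltr0n.
have d1 : 0 < 1 + delta by rewrite ltr_wpDr.
have W1_gt0 : 0 < W1.
  apply: mulr_gt0; first exact: exprn_gt0.
  by apply: mulr_gt0 => //; exact: mulr_gt0.
have W2_gt0 : 0 < W2.
  apply: mulr_gt0; first exact: exprn_gt0.
  exact: mulr_gt0.
apply: mean_leD; first apply: mean_leD; first exact: mean_le_cst.
  apply: mean_le_abs => //.
  rewrite ler_wpM2l ?sqr_ge0//.
  by have /ler_normlP[_] := sqn_block_sum f; lra.
apply: mean_le_sum => b; apply: mean_leD; last exact: mean_le_noise_avg.
apply: mean_leD.
  apply: mean_le_cst; rewrite addr_ge0//.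
  by rewrite mulr_ge0// mulr_ge0 ?sqr_ge0// mulr_ge0.
apply: mean_le_abs => //.
by rewrite ler_wpM2l ?sqr_ge0// sqn_xcol.
Qed.

Let N := (m%:R ^+ s : R).
Let N0 : 0 < N. Proof. by rewrite exprn_gt0. Qed.

Lemma measurable_tilt t f : measurable_fun setT (tilt t f).
Proof.
apply: measurableT_comp => //; apply: measurable_funB => //.
by apply: measurable_funM => //; exact: measurable_ip.
Qed.

Lemma measurable_mixture t : measurable_fun setT (mixture t).
Proof.
apply: measurable_funM => //; apply: measurable_sum => f; exact: measurable_tilt.
Qed.

Lemma mixture_gt0 t y : 0 < mixture t y.
Proof.
rewrite /mixture mulr_gt0 ?invr_gt0//.
rewrite (bigD1 [ffun=> Ordinal m0])//=.
by rewrite ltr_pwDl ?expR_gt0// sumr_ge0// => f _; exact: expR_ge0.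
Qed.

Lemma integral_tshift t f (g : n.-tuple R -> R) :
  measurable_fun setT g -> (forall y, 0 <= g y) ->
  (\int[gaussian n]_e (g (tshift (fun i => t * block_sum f i) e))%:E =
   \int[gaussian n]_e (g e * tilt t f e)%:E)%E.
Proof.
move=> mg g0.
rewrite (cameron_martin _ (f := fun y => (g y)%:E))//; last exact/measurable_EFinP.
apply: eq_integral => e _; rewrite -EFinM; congr (_ * expR _)%:E.
by rewrite ipZ sqnZ.
Qed.

Lemma sum_weights (a : R) : \sum_(f : {ffun 'I_s -> 'I_m}) N^-1 * a = a.
Proof.
rewrite sumr_const card_ffun !card_ord -mulr_natl natrX mulrA divff ?mul1r//.
by rewrite gt_eqF.
Qed.

(* Jensen's inequality under each shifted measure: the likelihood ratio of the null
   hypothesis to the auxiliary mixture is bounded below by exp (- E (exponent)). *)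
Lemma integral_min_mixture :
  ((expR (- fixed_exponent))%:E <=
   \int[gaussian n]_e (Num.min 1 (mixture A e))%:E)%E.
Proof.
pose g y := Num.min 1 (mixture A y) / mixture theta y.
have mg : measurable_fun setT g.
  rewrite (_ : g = fun y => Num.min 1 (mixture A y) * expR (- ln (mixture theta y))).
    apply: measurable_funM; first by apply: measurable_minr => //; exact: measurable_mixture.
    apply: measurableT_comp => //; apply: measurableT_comp => //.
    by apply: measurableT_comp; [exact: measurable_ln|exact: measurable_mixture].
  by apply/funext => y; rewrite expRN lnK// posrE mixture_gt0.
have g0 y : 0 <= g y.
  by rewrite divr_ge0 ?ltW ?mixture_gt0// lt_min ltr01 mixture_gt0.
(* L_theta is the average of the tilts, so min (1, L_A) = g L_theta splits into integrals of g under
   Gaussian shifts. *)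
have -> : (\int[gaussian n]_e (Num.min 1 (mixture A e))%:E =
    \int[gaussian n]_e (\sum_(f : {ffun 'I_s -> 'I_m}) (N^-1)%:E * (g e * tilt theta f e)%:E))%E.
  apply: eq_integral => e _; under eq_bigr do rewrite -EFinM.
  rewrite sumEFin -mulr_sumr -mulr_sumr mulrCA -/(mixture theta e) /g divfK//.
  by rewrite gt_eqF// mixture_gt0.
have mgt f : measurable_fun setT (fun e => (g e * tilt theta f e)%:E).
  by apply/measurable_EFinP/measurable_funM => //; exact: measurable_tilt.
have mNgt f : measurable_fun setT (fun e => (N^-1)%:E * (g e * tilt theta f e)%:E)%E.
  exact: emeasurable_funM.
have gt0 f e : (0 <= (g e * tilt theta f e)%:E)%E by rewrite lee_fin mulr_ge0 ?expR_ge0.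
have Ni0 : (0 <= (N^-1)%:E)%E by rewrite lee_fin invr_ge0 ltW.
rewrite (ge0_integral_sum (gaussian n) measurableT mNgt); last first.
  by move=> f e _; rewrite mule_ge0.
rewrite -(sum_weights (expR (- fixed_exponent))) -sumEFin; apply: lee_sum => f _.
rewrite ge0_integralZl// EFinM lee_wpmul2l// -integral_tshift//.
have [mD D0 Dc] := mean_le_total_exponent f.
apply: (le_trans (jensen_expRN mD D0 Dc)).
apply: ge0_le_integral => //.
- by apply/measurable_EFinP/measurableT_comp => //; exact: measurableT_comp.
- by apply/measurable_EFinP/measurableT_comp => //; exact: measurable_tshift.
move=> e _; rewrite lee_fin /g ler_pdivlMr ?mixture_gt0//.
apply: (le_trans (ler_wpM2l (expR_ge0 _) (mixture_le f e))).
rewrite -expRD /total_exponent opprD addrNK le_min.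
apply/andP; split; last exact: mixture_ge.
by rewrite -[leRHS]expR0 ler_expR oppr_le0 addr_ge0.
Qed.

(** After a change of measure the Bayes risk is the null mean of T + (1 - T) L_A, a convex
    combination of 1 and L_A, hence at least min (1, L_A). *)
Lemma bayes_risk_lower (T : n.-tuple R -> R) :
  measurable_fun setT T -> (forall y, 0 <= T y <= 1) ->
  ((expR (- fixed_exponent))%:E <=
   \int[gaussian n]_e (T e)%:E + \sum_(f : {ffun 'I_s -> 'I_m}) (N^-1)%:E *
     \int[gaussian n]_e (1 - T (tshift (lin X (fun j => A * block_ind f j)) e))%:E)%E.
Proof.
move=> mT T01.
have T0 y : 0 <= T y by have /andP[] := T01 y.
have T1 y : 0 <= 1 - T y by rewrite subr_ge0; have /andP[] := T01 y.
have mT1 : measurable_fun setT (fun y => 1 - T y) by exact: measurable_funB.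
have mTt f : measurable_fun setT (fun e => ((1 - T e) * tilt A f e)%:E).
  by apply/measurable_EFinP/measurable_funM => //; exact: measurable_tilt.
have Tt0 f e : (0 <= ((1 - T e) * tilt A f e)%:E)%E by rewrite lee_fin mulr_ge0 ?expR_ge0.
have Ni0 : (0 <= (N^-1)%:E)%E by rewrite lee_fin invr_ge0 ltW.
have mNT f : measurable_fun setT (fun e => (N^-1)%:E * ((1 - T e) * tilt A f e)%:E)%E.
  exact: emeasurable_funM.
apply: (le_trans integral_min_mixture).
have -> : (\sum_(f : {ffun 'I_s -> 'I_m}) (N^-1)%:E *
     \int[gaussian n]_e (1 - T (tshift (lin X (fun j => A * block_ind f j)) e))%:E =
   \int[gaussian n]_e \sum_(f : {ffun 'I_s -> 'I_m})
      ((N^-1)%:E * ((1 - T e) * tilt A f e)%:E))%E.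
  rewrite (ge0_integral_sum (gaussian n) measurableT mNT); last first.
    by move=> f e _; rewrite mule_ge0.
  apply: eq_bigr => f _; rewrite ge0_integralZl//; congr (_ * _)%E.
  rewrite -(integral_tshift A f mT1 T1); apply: eq_integral => e _.
  by congr (1 - T (tshift _ _))%:E; apply/funext => i; exact: lin_block_ind.
have mTE : measurable_fun setT (fun e => (T e)%:E) by exact/measurable_EFinP.
rewrite -ge0_integralD//; last 3 first.
- by move=> e _; rewrite lee_fin.
- by move=> e _; apply: sume_ge0 => f _; rewrite mule_ge0.
- exact: emeasurable_sum.
apply: ge0_le_integral => //.
- by move=> e _; rewrite lee_fin le_min ler01 ltW// mixture_gt0.
- by apply/measurable_EFinP/measurable_minr => //; exact: measurable_mixture.
- by apply: emeasurable_funD => //; exact: emeasurable_sum.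
move=> e _; under eq_bigr do rewrite -EFinM.
rewrite sumEFin -EFinD lee_fin -mulr_sumr -mulr_sumr mulrCA -/(mixture A e).
have := mixture_gt0 A e; have := T0 e; have := T1 e.
set L := mixture A e; set t := T e => t1 t0 L0.
have [L1|L1] := leP L 1.
  by have := ler_wpM2l t0 L1; lra.
by have := ler_wpM2l t1 (ltW L1); lra.
Qed.

End tilts.

End fixed_design_lower.
End block_prior.

(** * Averaging over the random design *)

Section minimax_lower.
Context {R : realType}.
Variables n p s m : nat.
Variable idx : 'I_s -> 'I_m -> 'I_p.
Hypothesis idx_inj : forall b k b' k', idx b k = idx b' k' -> b = b' /\ k = k'.
Variables (eta A kappa c1 c2 : R).
Hypotheses (eta0 : 0 <= eta).
Hypotheses (n0 : (0 < n)%N) (s0 : (0 < s)%N) (m0 : (0 < m)%N).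
Hypotheses (A0 : 0 < A) (kappa_half : 1 / 2 <= kappa).
Hypothesis c1_ge : s%:R * ln m%:R -
  A ^+ 2 * n%:R * s%:R * (1 - eta * s%:R) * (kappa - 1 / 2) <= c1.
Hypotheses (c1_ge0 : 0 <= c1) (c2_ge0 : 0 <= c2).
Hypothesis c2_ge : (kappa * A) ^+ 2 * n%:R * (1 / 2 + 3 / 2 * (eta * s%:R)) - ln m%:R <= c2.

(** The prior does not depend on the design, so the supremum is bounded below by a prior average
    before conditioning on X; the fixed-design bound is then integrated over good designs only. *)
Lemma minimax_risk_lower (mu : probability (design n p) R) :
  ((expR (- fixed_exponent n s eta A kappa c1 c2))%:E * mu (near_isometry eta) <=
   minimax_risk mu s A)%E.
Proof.
set C := expR _.
have C0 : 0 <= C by exact: expR_ge0.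
apply: le_ereal_inf_tmp => _ [T [mT T01] <-]; rewrite /risk_test.
have T0 o : 0 <= T o by have /andP[] := T01 o.
have T1 o : 0 <= 1 - T o by rewrite subr_ge0; have /andP[] := T01 o.
have mT1 : measurable_fun setT (fun o => 1 - T o) by exact: measurable_funB.
pose N : R := m%:R ^+ s.
have N0 : 0 < N by rewrite exprn_gt0// ltr0n.
have Ni0 : (0 <= (N^-1)%:E)%E by rewrite lee_fin invr_ge0 ltW.
pose bt (f : {ffun 'I_s -> 'I_m}) : 'I_p -> R := fun j => A * block_ind idx f j.
pose G (f : {ffun 'I_s -> 'I_m}) X :=
  (\int[gaussian n]_e (1 - T (tshift (lin X (bt f)) e, X))%:E)%E.
pose G0 X := (\int[gaussian n]_e (T (tshift (lin X (fun=> 0)) e, X))%:E)%E.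
have mG f : measurable_fun setT (G f).
  exact: (@measurable_expect_gaussian _ _ _ (bt f) (fun o => 1 - T o)).
have mG0 : measurable_fun setT G0 by exact: measurable_expect_gaussian.
have Gge0 f X : (0 <= G f X)%E by apply: integral_ge0 => e _; rewrite lee_fin.
have G0ge0 X : (0 <= G0 X)%E by apply: integral_ge0 => e _; rewrite lee_fin.
have sup_ge : (\sum_(f : {ffun 'I_s -> 'I_m}) (N^-1)%:E * \int[mu]_X G f X <=
    ereal_sup [set expect_beta mu beta (fun o => (1 - T o)%R) | beta in @Xi R p s A])%E.
  set S := ereal_sup _.
  have GS f : (\int[mu]_X G f X <= S)%E.
    apply: ereal_sup_ubound; exists (bt f); first exact: block_ind_Xi.
    by rewrite (expect_betaE mu (bt f) mT1 T1).
  have S0 : (0 <= S)%E.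
    by apply: le_trans (GS [ffun=> Ordinal m0]); exact: integral_ge0.
  apply: (@le_trans _ _ (\sum_(f : {ffun 'I_s -> 'I_m}) (N^-1)%:E * S)%E).
    by apply: lee_sum => f _; exact: lee_wpmul2l.
  rewrite -ge0_sume_distrl//.
  have := sum_weights s m0 (1 : R); rewrite /N; under eq_bigr do rewrite mulr1.
  by rewrite sumEFin => ->; rewrite mul1e.
apply: (le_trans _ (leeD2l _ sup_ge)).
rewrite (expect_betaE mu (fun=> 0) mT T0) -/G0.
have mNG f : measurable_fun setT (fun X => (N^-1)%:E * G f X)%E.
  exact: emeasurable_funM.
have -> : (\sum_(f : {ffun 'I_s -> 'I_m}) (N^-1)%:E * \int[mu]_X G f X =
    \int[mu]_X \sum_(f : {ffun 'I_s -> 'I_m}) (N^-1)%:E * G f X)%E.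
  rewrite (ge0_integral_sum mu measurableT mNG); last first.
    by move=> f X _; rewrite mule_ge0.
  by apply: eq_bigr => f _; rewrite ge0_integralZl.
have mS : measurable_fun setT
    (fun X => \sum_(f : {ffun 'I_s -> 'I_m}) (N^-1)%:E * G f X)%E.
  exact: emeasurable_sum.
have S0 X : setT X -> (0 <= \sum_(f : {ffun 'I_s -> 'I_m}) (N^-1)%:E * G f X)%E.
  by move=> _; apply: sume_ge0 => f _; rewrite mule_ge0.
have G00 X : setT X -> (0 <= G0 X)%E by move=> _; exact: G0ge0.
have <- := ge0_integralD mu measurableT G00 mG0 S0 mS.
have mnear := @measurable_near_isometry R n p eta.
have -> : (mu (near_isometry eta) = \int[mu]_X (\1_(near_isometry eta) X : R)%:E)%E.
  by rewrite integral_indic// setIT.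
have mI : measurable_fun setT (fun X : design n p => (\1_(near_isometry eta) X : R)%:E).
  by apply/measurable_EFinP/measurable_indic.
rewrite -ge0_integralZl//.
apply: ge0_le_integral => //.
- by move=> X _; rewrite -EFinM lee_fin mulr_ge0.
- exact: emeasurable_funM.
- exact: emeasurable_funD.
move=> X _; rewrite indicE; have [GX|GX] := pselect (near_isometry eta X); last first.
  rewrite memNset// mule0 adde_ge0//.
  by apply: sume_ge0 => f _; rewrite mule_ge0.
rewrite mem_set// mule1.
have mTX : measurable_fun setT (fun y : n.-tuple R => T (y, X)).
  exact: (measurableT_comp mT (pair2_measurable X)).
have := bayes_risk_lower idx_inj GX s0 eta0 m0 A0 kappa_half c1_ge c2_ge0 c2_ge n0 c1_ge0
  mTX (fun y => T01 _).
move=> /le_trans; apply; apply: leeD => //.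
rewrite le_eqVlt; apply/orP; left; apply/eqP; apply: eq_integral => e _.
congr (T (_, X))%:E; apply: eq_from_tnth => i; rewrite tnth_mktuple /lin big1 ?add0r//.
by move=> j _; rewrite mulr0.
Qed.

End minimax_lower.

(** * Concentration of the empirical covariance *)

Section scalar_exponential_bounds.
Context {R : realType}.
Implicit Types z t : R.

(** From e^z - 1 <= z e^z follows e^z - 1 - z <= z (e^z - 1), and e^z - 1 is at most |z| e^|z| in
    absolute value. *)
Lemma expR_le_quadratic z : expR z <= 1 + z + z ^+ 2 * expR `|z|.
Proof.
have h1 : expR z - 1 <= z * expR z.
  have := ler_wpM2l (expR_ge0 z) (expR_ge1Dx (- z)).
  by rewrite -expRD subrr expR0; lra.
have h2 := expR_ge1Dx z; have e0 := expR_ge0 z.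
have [z0|z0] := leP 0 z.
  rewrite ger0_norm//.
  have := ler_wpM2l z0 h1; lra.
rewrite ltr0_norm//.
have e1 : 1 <= expR (- z) by rewrite -expR0 ler_expR oppr_ge0 ltW.
have z2 : z ^+ 2 <= z ^+ 2 * expR (- z) by rewrite ler_peMr// sqr_ge0.
have nz : 0 <= - z by rewrite oppr_ge0 ltW.
have := ler_wpM2l nz h2; lra.
Qed.

Lemma sqr_le_expR t : 0 <= t -> t ^+ 2 / 4 <= expR t.
Proof.
move=> t0; have h := expR_ge1Dx (t / 2).
have -> : expR t = expR (t / 2) ^+ 2 by rewrite -expRM_natl; congr expR; lra.
have h0 : 0 <= 1 + t / 2 by lra.
have : (1 + t / 2) ^+ 2 <= expR (t / 2) ^+ 2 by rewrite lerXn2r// nnegrE ?expR_ge0.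
by have := sqr_ge0 t; nra.
Qed.

(** The exponential budget kap |w| is split in two: one half bounds exp |lam w|, the other absorbs
    w^2. The factor 16 / kap^2 comes from [sqr_le_expR] at t = kap |w| / 2. *)
Lemma expR_quadratic_bound (kap lam w : R) : 0 < kap -> `|lam| <= kap / 2 ->
  expR (lam * w) <= 1 + lam * w + 16 / kap ^+ 2 * lam ^+ 2 * expR (kap * `|w|).
Proof.
move=> k0 lk; apply: (le_trans (expR_le_quadratic _)); rewrite lerD2l.
rewrite normrM exprMn.
have t0 : 0 <= kap * `|w| / 2 by rewrite divr_ge0// mulr_ge0// ltW.
have h1 := sqr_le_expR t0.
have h2 : expR (`|lam| * `|w|) <= expR (kap * `|w| / 2).
  by rewrite ler_expR mulrAC ler_wpM2r.
have -> : expR (kap * `|w|) = expR (kap * `|w| / 2) * expR (kap * `|w| / 2).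
  by rewrite -expRD; congr expR; lra.
have h3 : w ^+ 2 <= 16 / kap ^+ 2 * expR (kap * `|w| / 2).
  rewrite mulrAC ler_pdivlMr ?exprn_gt0//.
  have : (kap * `|w| / 2) ^+ 2 / 4 = w ^+ 2 * kap ^+ 2 / 16.
    by rewrite -[w ^+ 2]real_normK ?num_real//; field.
  by move: h1 => /[swap] ->; lra.
have l2 := sqr_ge0 lam.
have -> : 16 / kap ^+ 2 * lam ^+ 2 * (expR (kap * `|w| / 2) * expR (kap * `|w| / 2)) =
  lam ^+ 2 * (16 / kap ^+ 2 * expR (kap * `|w| / 2)) * expR (kap * `|w| / 2) by ring.
apply: ler_pM => //; first by rewrite mulr_ge0 ?sqr_ge0.
exact: ler_wpM2l.
Qed.

End scalar_exponential_bounds.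

(** * Exponential moments of a sub-Gaussian row *)

Section sub_gaussian.
Context {R : realType}.

Lemma std_normal_mgf (c : R) :
  (\int[std_normal]_g (expR (c * g))%:E = (expR (c ^+ 2 / 2))%:E)%E.
Proof.
have := @gaussian_mgf R 1 (fun=> c).
rewrite /gaussian integral_iidS//; last first.
  by apply/measurable_EFinP/measurableT_comp => //; exact: measurable_ip.
have -> : sqn (fun=> c : R) (n := 1) = c ^+ 2 by rewrite /sqn big_ord1.
move=> <-; apply: eq_integral => g _; rewrite integral_iid0//.
  by rewrite /ip big_ord1.
apply/measurable_EFinP/measurableT_comp => //.
under eq_fun do rewrite /ip big_ord1 tnth_cons0.
exact: measurable_cst.
Qed.

(* Averaging the sub-Gaussian bound over a Gaussian parameter t gives square-exponential moments. *)
Lemma sub_gaussian_sqr d (T : measurableType d) (P : probability T R) (U : T -> R)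
    (S kap : R) :
  measurable_fun setT U -> 0 <= kap -> kap * S <= 3 / 8 ->
  (forall t : R, (\int[P]_x (expR (t * U x))%:E <= (expR (S * t ^+ 2 / 2))%:E)%E) ->
  (\int[P]_x (expR (kap * U x ^+ 2))%:E <= 2%:E)%E.
Proof.
move=> mU k0 kS subg.
pose h (z : T * R) := (expR (Num.sqrt (2 * kap) * U z.1 * z.2))%:E.
have mh : measurable_fun setT h.
  apply/measurable_EFinP/measurableT_comp => //; apply: measurable_funM => //.
  apply: measurable_funM => //; exact: (measurableT_comp mU).
have h0 z : (0 <= h z)%E by rewrite lee_fin expR_ge0.
have sq : Num.sqrt (2 * kap) ^+ 2 = 2 * kap by rewrite sqr_sqrtr// mulr_ge0.
have -> : (\int[P]_x (expR (kap * U x ^+ 2))%:E =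
    \int[P]_x \int[std_normal]_g h (x, g))%E.
  apply: eq_integral => x _.
  apply: (etrans _ (esym (std_normal_mgf (Num.sqrt (2 * kap) * U x)))); rewrite exprMn sq.
  by congr (expR _)%:E; lra.
rewrite (fubini_tonelli h mh h0).
have m38 : measurable_fun setT (fun x : R => (expR (3 / 8 * x ^+ 2))%:E).
  apply/measurable_EFinP/measurableT_comp => //; exact: measurable_funM.
rewrite -(@normal_expR_sqr R) -integral_std_normal//.
apply: ge0_le_integral => //.
- by move=> g _; exact: integral_ge0.
- exact: (measurable_fun_fubini_tonelli_G h).
move=> g _.
have -> : (\int[P]_x h (x, g) = \int[P]_x (expR (Num.sqrt (2 * kap) * g * U x))%:E)%E.
  by apply: eq_integral => x _; rewrite /h/= mulrAC.
(* The exponent becomes S kap g^2 <= 3/8 g^2, whose Gaussian integral is 2. *)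
apply: (le_trans (subg _)); rewrite lee_fin ler_expR exprMn sq.
have := ler_wpM2r (sqr_ge0 g) kS; lra.
Qed.

(** Its product with max (sigma2, 1) is exactly 3/8, the constant of [normal_expR_sqr]; the maximum
    keeps the rate positive and at most 1 for every real [sigma2]. *)
Definition sub_gaussian_rate (sigma2 : R) : R := 3 / (8 * Num.max sigma2 1).

(** The factor 16 / kap^2 of [expR_quadratic_bound] times the moment bound 2 e^kap of
    [prod_dev_exp_moment]. *)
Definition covariance_rate (sigma2 : R) : R :=
  16 / sub_gaussian_rate sigma2 ^+ 2 * (2 * expR (sub_gaussian_rate sigma2)).

Variables (p : nat) (nu : probability (p.-tuple R) R) (sigma2 : R).
Hypothesis subg : centered_isotropic_subG sigma2 nu.
Let kap := sub_gaussian_rate sigma2.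
Let C := covariance_rate sigma2.

Definition prod_dev (j k : 'I_p) (x : p.-tuple R) : R :=
  tnth x j * tnth x k - (j == k)%:R.

Lemma sub_gaussian_rate_gt0 : 0 < kap.
Proof. by rewrite divr_gt0// mulr_gt0// lt_max ltr01 orbT. Qed.

Lemma sub_gaussian_rate_le1 : kap <= 1.
Proof.
have m0 : 1 <= Num.max sigma2 1 by rewrite le_max lexx orbT.
by rewrite /kap /sub_gaussian_rate ler_pdivrMr; lra.
Qed.

Lemma coord_sqr (j : 'I_p) :
  (\int[nu]_x (expR (kap * tnth x j ^+ 2))%:E <= 2%:E)%E.
Proof.
have m0 : 1 <= Num.max sigma2 1 by rewrite le_max lexx orbT.
apply: (@sub_gaussian_sqr _ _ nu (fun x => tnth x j) (Num.max sigma2 1) kap).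
- exact: measurable_tnth.
- exact/ltW/sub_gaussian_rate_gt0.
- rewrite /kap /sub_gaussian_rate le_eqVlt; apply/orP; left; apply/eqP.
  by field; rewrite gt_eqF//; apply: lt_le_trans m0.
move=> t; have [_ _ H] := subg.
have := H (fun k => (k == j)%:R) _ t.
rewrite (_ : \sum_(k < p) ((k == j)%:R : R) ^+ 2 = 1); last first.
  rewrite (bigD1 j)//= eqxx expr1n big1 ?addr0// => k /negbTE ->.
  by rewrite expr0n.
move=> /(_ erefl); under eq_integral => x _.
  rewrite (_ : \sum_(k < p) _ = tnth x j); last first.
    rewrite (bigD1 j)//= eqxx mul1r big1 ?addr0// => k /negbTE ->.
    by rewrite mul0r.
  over.
move=> /le_trans; apply; rewrite lee_fin ler_expR.
have : sigma2 <= Num.max sigma2 1 by rewrite le_max lexx.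
by move=> /(ler_wpM2r (sqr_ge0 t)); lra.
Qed.

Lemma measurable_prod_dev j k : measurable_fun setT (prod_dev j k).
Proof.
by apply: measurable_funB => //; apply: measurable_funM; exact: measurable_tnth.
Qed.

(** The two coordinates of a row may be dependent: |a b| <= (a^2 + b^2) / 2, followed by the
    arithmetic-geometric inequality for the exponentials, separates them. *)
Lemma prod_dev_exp_moment j k :
  (\int[nu]_x (expR (kap * `|prod_dev j k x|))%:E <= (2 * expR kap)%:E)%E.
Proof.
have k0 := ltW sub_gaussian_rate_gt0.
have mc i : measurable_fun setT (fun x : p.-tuple R => (expR (kap * tnth x i ^+ 2))%:E).
  apply/measurable_EFinP/measurableT_comp => //; apply: measurable_funM => //.
  by apply: measurable_funX; exact: measurable_tnth.
have mcc : measurable_fun setT (fun x : p.-tuple R =>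
    (expR (kap * tnth x j ^+ 2))%:E + (expR (kap * tnth x k ^+ 2))%:E)%E.
  exact: emeasurable_funD.
have e2 : 0 <= expR kap / 2 by rewrite divr_ge0 ?expR_ge0.
apply: (@le_trans _ _ (\int[nu]_x ((expR kap / 2)%:E *
    ((expR (kap * tnth x j ^+ 2))%:E + (expR (kap * tnth x k ^+ 2))%:E)))%E).
  apply: ge0_le_integral => //.
  - apply/measurable_EFinP/measurableT_comp => //; apply: measurable_funM => //.
    by apply: measurableT_comp => //; exact: measurable_prod_dev.
  - exact: emeasurable_funM.
  move=> x _; rewrite -EFinD -EFinM lee_fin /prod_dev.
  set a := tnth x j; set b := tnth x k.
  have h : `|a * b - (j == k)%:R| <= 1 + (a ^+ 2 + b ^+ 2) / 2.
    apply: (le_trans (ler_normB _ _)); rewrite normr_nat addrC lerD ?lern1 ?leq_b1//.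
    rewrite normrM -[a ^+ 2]real_normK ?num_real// -[b ^+ 2]real_normK ?num_real//.
    have := sqr_ge0 (`|a| - `|b|); lra.
  have ea := expR_ge0 (kap * a ^+ 2 / 2); have eb := expR_ge0 (kap * b ^+ 2 / 2).
  apply: (@le_trans _ _ (expR kap * (expR (kap * a ^+ 2 / 2) * expR (kap * b ^+ 2 / 2)))).
    by rewrite -!expRD ler_expR; have := ler_wpM2l k0 h; lra.
  have -> : expR (kap * a ^+ 2) = expR (kap * a ^+ 2 / 2) ^+ 2.
    by rewrite -expRM_natl; congr expR; lra.
  have -> : expR (kap * b ^+ 2) = expR (kap * b ^+ 2 / 2) ^+ 2.
    by rewrite -expRM_natl; congr expR; lra.
  have := ler_wpM2l (expR_ge0 kap)
    (sqr_ge0 (expR (kap * a ^+ 2 / 2) - expR (kap * b ^+ 2 / 2))); lra.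
rewrite ge0_integralZl//; last by move=> x _; rewrite adde_ge0// lee_fin expR_ge0.
rewrite ge0_integralD//.
have := leeD (coord_sqr j) (coord_sqr k); rewrite -EFinD => H.
have e2' : (0 <= (expR kap / 2)%:E)%E by rewrite lee_fin.
apply: (le_trans (lee_wpmul2l e2' H)).
by rewrite -EFinM lee_fin; lra.
Qed.

Lemma integrable_prod_dev j k : nu.-integrable setT (fun x => (prod_dev j k x)%:E).
Proof.
have k0 := sub_gaussian_rate_gt0.
apply/integrableP; split.
  by apply/measurable_EFinP; exact: measurable_prod_dev.
apply: (@le_lt_trans _ _ (\int[nu]_x ((kap^-1)%:E * (expR (kap * `|prod_dev j k x|))%:E))%E).
  apply: ge0_le_integral => //.
  - by apply: measurableT_comp => //; apply/measurable_EFinP; exact: measurable_prod_dev.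
  - apply: emeasurable_funM => //; apply/measurable_EFinP/measurableT_comp => //.
    apply: measurable_funM => //; apply: measurableT_comp => //; exact: measurable_prod_dev.
  move=> x _; rewrite -EFinM lee_fin mulrC ler_pdivlMr// mulrC.
  by have := expR_ge1Dx (kap * `|prod_dev j k x|); lra.
rewrite ge0_integralZl//; last 2 first.
- apply/measurable_EFinP/measurableT_comp => //.
  apply: measurable_funM => //; apply: measurableT_comp => //; exact: measurable_prod_dev.
- by rewrite lee_fin invr_ge0 ltW.
have ki : (0 <= (kap^-1)%:E)%E by rewrite lee_fin invr_ge0 ltW.
apply: (le_lt_trans (lee_wpmul2l ki (prod_dev_exp_moment j k))).
by rewrite -EFinM ltry.
Qed.

Lemma integral_prod_dev j k : (\int[nu]_x (prod_dev j k x)%:E = 0)%E.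
Proof.
have [_ cov _] := subg.
have i1 : nu.-integrable setT (fun=> ((j == k)%:R : R)%:E).
  exact: finite_measure_integrable_cst.
have i2 : nu.-integrable setT (fun x : p.-tuple R => (tnth x j * tnth x k)%:E).
  have := integrableD measurableT (integrable_prod_dev j k) i1.
  apply: eq_integrable => // x _.
  by rewrite /= -EFinD /prod_dev subrK.
under eq_integral do rewrite /prod_dev EFinB.
rewrite integralB//= cov integral_cst_probability -EFinB.
by rewrite subrr.
Qed.

(** In the integral of [expR_quadratic_bound] isotropy removes the linear term; 1 + u <= e^u then
    gives a form that multiplies over the rows. *)
Lemma prod_dev_mgf j k (lam : R) : `|lam| <= kap / 2 ->
  (\int[nu]_x (expR (lam * prod_dev j k x))%:E <= (expR (C * lam ^+ 2))%:E)%E.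
Proof.
move=> lk; have k0 := sub_gaussian_rate_gt0.
have mW := measurable_prod_dev j k.
have mE : measurable_fun setT (fun x => (expR (kap * `|prod_dev j k x|))%:E).
  apply/measurable_EFinP/measurableT_comp => //.
  apply: measurable_funM => //; exact: measurableT_comp.
have Efin : (\int[nu]_x (expR (kap * `|prod_dev j k x|))%:E < +oo)%E.
  by apply: le_lt_trans (prod_dev_exp_moment j k) _; rewrite ltry.
have iE : nu.-integrable setT (fun x => (expR (kap * `|prod_dev j k x|))%:E).
  apply/integrableP; split => //.
  by under eq_integral do rewrite gee0_abs ?lee_fin ?expR_ge0//.
have i1 : nu.-integrable setT (fun=> (1 : R)%:E) by exact: finite_measure_integrable_cst.
have iW := integrable_prod_dev j k.
have D0 : 0 <= 16 / kap ^+ 2 * lam ^+ 2 by rewrite mulr_ge0 ?sqr_ge0// divr_ge0 ?sqr_ge0.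
have iW' : nu.-integrable setT (fun x => lam%:E * (prod_dev j k x)%:E)%E by exact: integrableZl.
have iE' : nu.-integrable setT (fun x => (16 / kap ^+ 2 * lam ^+ 2)%:E *
   (expR (kap * `|prod_dev j k x|))%:E)%E by exact: integrableZl.
have i1W : nu.-integrable setT (fun x => 1%:E + lam%:E * (prod_dev j k x)%:E)%E.
  exact: integrableD.
apply: (@le_trans _ _ (\int[nu]_x (1%:E + lam%:E * (prod_dev j k x)%:E +
   (16 / kap ^+ 2 * lam ^+ 2)%:E * (expR (kap * `|prod_dev j k x|))%:E))%E).
  apply: ge0_le_integral => //.
  - by apply/measurable_EFinP/measurableT_comp => //; exact: measurable_funM.
  - by apply: (measurable_int nu); exact: integrableD.
  move=> x _; rewrite -!EFinM -!EFinD lee_fin; exact: expR_quadratic_bound.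
rewrite integralD// integralD// integral_cst_probability integralZl// integral_prod_dev.
rewrite mule0 adde0 ge0_integralZl//.
have := lee_wpmul2l _ (prod_dev_exp_moment j k) => /(_ (16 / kap ^+ 2 * lam ^+ 2)%:E).
rewrite lee_fin => /(_ D0) /(leeD2l 1%:E) /le_trans; apply.
rewrite -EFinM -EFinD lee_fin.
apply: le_trans (expR_ge1Dx _).
rewrite lerD2l /C /covariance_rate -/kap.
by rewrite mulrAC.
Qed.

End sub_gaussian.

Section design_concentration.
Context {R : realType}.
Variables n p : nat.
Variable mu : probability (@design R n p) R.

Lemma near_isometry_orthogonal (eta : R) : 0 <= eta ->
  {ae mu, forall X, XtX X = n%:R%:M} -> mu (~` near_isometry eta) = 0%E.
Proof.
move=> eta0 [N [mN N0 sN]].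
have mG := @measurable_near_isometry R n p eta.
apply/eqP; rewrite eq_le measure_ge0 andbT -N0.
apply: le_measure; rewrite ?inE//; first exact: measurableC.
move=> X GX; apply: sN => /= XE; apply: GX => j k.
have -> : gram X j k = XtX X j k.
  by rewrite /XtX !mxE; apply: eq_bigr => i _; rewrite !mxE.
by rewrite XE mxE -[X in X - _]mulr_natr subrr normr0 mulr_ge0.
Qed.

Variables (nu : probability (p.-tuple R) R) (sigma2 : R).
Hypotheses (iid_mu : rows_iid mu nu) (subg : centered_isotropic_subG sigma2 nu).
Let C := covariance_rate sigma2.

Lemma covariance_rate_gt0 : 0 < C.
Proof.
apply: mulr_gt0; last by rewrite mulr_gt0 ?expR_gt0.
by apply: divr_gt0 => //; apply: exprn_gt0; exact: sub_gaussian_rate_gt0.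
Qed.

Let gramE (X : @design R n p) (j k : 'I_p) :
  gram X j k - n%:R * (j == k)%:R = \sum_(i < n) prod_dev j k (tnth X i).
Proof.
by rewrite sumrB sumr_const card_ord -[X in _ = _ - X]mulr_natl.
Qed.

Let mean_le_dev (j k : 'I_p) (lam c : R) : `|lam| <= sub_gaussian_rate sigma2 / 2 ->
  mean_le mu (fun X => expR (lam * (gram X j k - n%:R * (j == k)%:R) + c))
    (expR (n%:R * (C * lam ^+ 2) + c)).
Proof.
move=> lk.
have mF : measurable_fun setT
    (fun X : design n p => expR (lam * (gram X j k - n%:R * (j == k)%:R) + c)).
  apply: measurableT_comp => //; apply: measurable_funD => //.
  apply: measurable_funM => //; apply: measurable_funB => //; exact: measurable_gram.
split => //.
have -> : (\int[mu]_X (expR (lam * (gram X j k - n%:R * (j == k)%:R) + c))%:E =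
    \int[iid nu n]_X (expR (lam * (gram X j k - n%:R * (j == k)%:R) + c))%:E)%E.
  by apply: eq_measure_integral => B mB _; exact: iid_unique.
have mh : measurable_fun setT (fun x : p.-tuple R => lam * prod_dev j k x).
  by apply: measurable_funM => //; exact: measurable_prod_dev.
have := iid_expR_sum_le n mh (prod_dev_mgf subg j k lk).
rewrite -expRM_natl => H.
have ec : (0 <= (expR c)%:E)%E by rewrite lee_fin expR_ge0.
have := lee_wpmul2l ec H; rewrite -EFinM -expRD [c + _]addrC => /(le_trans _); apply.
rewrite -ge0_integralZl//; last first.
  by apply/measurable_EFinP/measurableT_comp => //; exact: (measurable_sum_tnth (n := n) mh).
rewrite le_eqVlt; apply/orP; left; apply/eqP; apply: eq_integral => X _.
by rewrite -EFinM -expRD gramE mulr_sumr addrC.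
Qed.

(** Chernoff plus a union bound over p^2 entries and two signs: the indicator of a bad design is
    dominated by a sum of exponentials. *)
Lemma near_isometry_subG (eta : R) : 0 <= eta <= 1 ->
  (mu (~` near_isometry eta) <=
   (2 * p%:R ^+ 2 * expR (- (n%:R * eta ^+ 2 / (4 * C))))%:E)%E.
Proof.
move=> /andP[eta0 eta1].
have C0 := covariance_rate_gt0.
(* Minimises n (C lam^2 - lam eta), with value - n eta^2 / (4 C); eta <= 1 keeps it in the range
   allowed by [prod_dev_mgf]. *)
pose lam := eta / (2 * C).
have lam0 : 0 <= lam by rewrite divr_ge0// mulr_ge0// ltW.
have k0 := sub_gaussian_rate_gt0 sigma2.
have lk : `|lam| <= sub_gaussian_rate sigma2 / 2.
  have C20 : 0 < 2 * C by exact: mulr_gt0.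
  rewrite ger0_norm// ler_pdivrMr//.
  apply: (le_trans eta1).
  set k := sub_gaussian_rate sigma2 in k0 *.
  have k1 : k <= 1 by exact: sub_gaussian_rate_le1.
  have -> : k / 2 * (2 * C) = 32 * expR k / k.
    by rewrite /C /covariance_rate -/k; field; rewrite gt_eqF.
  rewrite ler_pdivlMr// mul1r; apply: (le_trans k1).
  have := expR_ge1Dx k; lra.
have lk' : `|- lam| <= sub_gaussian_rate sigma2 / 2 by move: lk; rewrite -(normrN lam).
pose c := - (lam * (n%:R * eta)).
pose E := expR (n%:R * (C * lam ^+ 2) + c).
have Em : mean_le mu (fun X => \sum_(j < p) \sum_(k < p)
    (expR (lam * (gram X j k - n%:R * (j == k)%:R) + c) +
     expR (- lam * (gram X j k - n%:R * (j == k)%:R) + c)))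
    (p%:R * (p%:R * (E + E))).
  apply: mean_le_sum => j; apply: mean_le_sum => k; apply: mean_leD.
    exact: mean_le_dev.
  by rewrite /E -(sqrrN lam); exact: mean_le_dev.
have EE : E = expR (- (n%:R * eta ^+ 2 / (4 * C))).
  by rewrite /E /c /lam; congr expR; field; rewrite gt_eqF.
have -> : 2 * p%:R ^+ 2 * expR (- (n%:R * eta ^+ 2 / (4 * C))) =
    p%:R * (p%:R * (E + E)) by rewrite EE; ring.
have [mEm _ Emean] := Em; apply: le_trans Emean.
have mG := @measurable_near_isometry R n p eta.
have mGC := measurableC mG.
have -> : (mu (~` near_isometry eta) =
    \int[mu]_X (\1_(~` near_isometry eta) X : R)%:E)%E.
  by rewrite integral_indic// setIT.
apply: ge0_le_integral => //.
- by apply/measurable_EFinP/measurable_indic.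
- exact/measurable_EFinP.
move=> X _; rewrite lee_fin indicE.
have t0 j k : 0 <= expR (lam * (gram X j k - n%:R * (j == k)%:R) + c) +
     expR (- lam * (gram X j k - n%:R * (j == k)%:R) + c).
  by rewrite addr_ge0// expR_ge0.
have [GX|GX] := pselect (near_isometry eta X).
  by rewrite memNset; [do 2 (apply: sumr_ge0 => ? _)|apply].
rewrite mem_set//.
move/existsNP : GX => [j /existsNP[k /negP]]; rewrite -ltNge => jk.
rewrite (bigD1 j)//= (bigD1 k)//= -addrA ler_wpDr//.
  by rewrite addr_ge0// sumr_ge0// => ? _; rewrite ?sumr_ge0.
set z := gram X j k - _ in jk *.
have e0 t : 0 <= expR t :> R by exact: expR_ge0.
have [z0|z0] := leP 0 z.
  rewrite ger0_norm// in jk.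
  apply: ler_wpDr => //; rewrite -expR0 ler_expR /c.
  by rewrite -mulrBr mulr_ge0// subr_ge0 ltW.
rewrite ltr0_norm// in jk.
apply: ler_wpDl => //; rewrite -expR0 ler_expR /c.
by rewrite mulNr -opprD oppr_ge0 -mulrDr mulr_ge0_le0// -(opprK z) addrC subr_le0 ltW.
Qed.

End design_concentration.

(** * Asymptotics *)

(** Here D is the rate, a = alpha, L = log p and Z = log (p / s): the threshold costs (D + a) S L,
    the supports give back S Z, and 2 S comes from (1 + 2 x)^p. *)
Lemma type1_exponent {R : realType} (S Z D a L : R) : S * Z <= S * (a * L + 1) ->
  - ((D + a) * S * L) + S * Z + 2 * S <= S * (3 - D * L).
Proof. lra. Qed.

(** Arithmetic of [fixed_exponent], with d = delta, D the rate, T = tau, E = e^(1/2), and Q, Q1, Q2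
    the square roots measuring Gaussian fluctuations. *)
Lemma lower_exponent {R : realType} (S d a L D T r E Q1 Q2 Q : R) :
  S * (d * L) * (a + 7 * T) <= S * (d * L) * (8 * r) ->
  2 * E * Q1 <= 2 * E * (S * Q) -> S * (2 * E * Q2) <= S * (2 * E * Q) ->
  S * (d * a * L) + 2 * E * Q1 +
  S * (L * (D + 3 * d * T) + 1 + 4 * d * T * L + 2 * E * Q2 + 1) <=
  S * (L * (D + 8 * d * r) + 2 + 4 * E * Q).
Proof. lra. Qed.

Section rates.
Context {R : realType}.
Variables alpha r : R.
Hypotheses (alpha_half : 1 / 2 < alpha) (alpha1 : alpha < 1) (alpha_r : alpha < r).

Definition detection_rate : R := (r - alpha) ^+ 2 / (4 * r).

Let kappa := (r + alpha) / (2 * r).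
Let tau := kappa ^+ 2 * r.

Let alpha0 : 0 < alpha. Proof. by move: alpha_half; lra. Qed.
Let r0 : 0 < r. Proof. exact: lt_trans alpha_r. Qed.
Let r_neq0 : r != 0. Proof. by rewrite gt_eqF. Qed.

Lemma detection_rate_ge0 : 0 <= detection_rate.
Proof. by rewrite divr_ge0 ?sqr_ge0// mulr_ge0// ltW. Qed.

Let kappa_halfE : kappa - 1 / 2 = alpha / (2 * r).
Proof. by rewrite /kappa; field. Qed.

Let kappa_half : 1 / 2 <= kappa.
Proof. by rewrite -subr_ge0 kappa_halfE divr_ge0// ?mulr_ge0// ltW. Qed.

Let kappa_gt0 : 0 < kappa.
Proof. by apply: lt_le_trans kappa_half; lra. Qed.

Let kappa_lt1 : kappa < 1.
Proof. by rewrite /kappa ltr_pdivrMr ?mulr_gt0//; move: alpha_r; lra. Qed.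

Let tauE : tau = detection_rate + alpha.
Proof. by rewrite /tau /kappa /detection_rate; field. Qed.

Let tau_le : tau <= r.
Proof.
by rewrite /tau; apply: ler_piMl; [exact: ltW|apply: exprn_ile1; exact: ltW].
Qed.

Let tau_gt0 : 0 < tau.
Proof. by rewrite mulr_gt0// exprn_gt0. Qed.

Let onem_kappaE : 1 - kappa = (r - alpha) / (2 * r).
Proof. by rewrite /kappa; field. Qed.

(** * Error exponents at fixed n and p *)

Section fixed_size.
Variables (n p : nat).
Let l : R := ln p%:R.
Hypotheses (n0 : (0 < n)%N) (l1 : 1 <= l).
Let s := sparsity alpha p.
Let A := amplitude r n p.
Let m := Num.truncn (p%:R `^ alpha : R).

Let p0 : (0 < p)%N.
Proof.
rewrite lt0n; apply/eqP => p0; move: l1; rewrite /l p0 ln0//.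
by rewrite lt_geF.
Qed.

Let pR : (0 : R) < p%:R. Proof. by rewrite ltr0n. Qed.
Let l0 : 0 < l. Proof. exact: lt_le_trans l1. Qed.

Let powE (a : R) : p%:R `^ a = expR (a * l).
Proof. by rewrite /powR gt_eqF. Qed.

(** Since p^a >= 1, truncation loses at most a factor 2, that is an additive ln 2 <= 1 in the
    logarithms below. *)
Let truncn_bounds (a : R) : 0 <= a ->
  let t : R := (Num.truncn (p%:R `^ a : R))%:R in
  t <= expR (a * l) /\ expR (a * l) <= 2 * t.
Proof.
move=> a0 t; have e1 : 1 <= expR (a * l).
  by rewrite -expR0 ler_expR mulr_ge0// ltW.
have e0 : 0 <= expR (a * l) by exact: expR_ge0.
have := truncn_itv e0; rewrite -powE => /andP[h1 h2]; split => //.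
have t1 : 1 <= t.
  rewrite /t ler1n lt0n; apply/eqP => t0.
  by move: h2; rewrite t0 powE ltNge e1.
by apply: (le_trans (ltW h2)); rewrite -natr1 -/t; lra.
Qed.

Lemma sparsity_le : s%:R <= expR ((1 - alpha) * l).
Proof.
by have [] := @truncn_bounds (1 - alpha); first by rewrite subr_ge0 ltW.
Qed.

Let sparsity_ge : expR ((1 - alpha) * l) <= 2 * s%:R.
Proof.
by have [] := @truncn_bounds (1 - alpha); first by rewrite subr_ge0 ltW.
Qed.

Let m_le : m%:R <= expR (alpha * l).
Proof. by have [] := @truncn_bounds alpha (ltW alpha0). Qed.

Let m_ge : expR (alpha * l) <= 2 * m%:R.
Proof. by have [] := @truncn_bounds alpha (ltW alpha0). Qed.

Lemma sparsity_gt0 : (0 < s)%N.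
Proof.
rewrite -(ltr0n R); have := lt_le_trans (expR_gt0 _) sparsity_ge; lra.
Qed.

Let m0 : (0 < m)%N.
Proof. by rewrite -(ltr0n R); have := lt_le_trans (expR_gt0 _) m_ge; lra. Qed.

Let sR : (0 : R) < s%:R. Proof. by rewrite ltr0n sparsity_gt0. Qed.
Let mR : (0 : R) < m%:R. Proof. by rewrite ltr0n m0. Qed.
Let s1 : (1 : R) <= s%:R. Proof. by rewrite ler1n sparsity_gt0. Qed.
Let nR : (0 : R) < n%:R. Proof. by rewrite ltr0n. Qed.

Let expl : expR l = p%:R. Proof. by rewrite lnK// posrE. Qed.

Let sm_le : (s * m <= p)%N.
Proof.
rewrite -(ler_nat R) natrM -expl.
have -> : l = (1 - alpha) * l + alpha * l by ring.
by rewrite expRD ler_pM// ?sparsity_le.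
Qed.

Let ln2 : ln (2 : R) <= 1.
Proof.
rewrite -[leRHS]expRK ler_ln ?posrE ?expR_gt0//.
by have := expR_ge1Dx (1 : R); lra.
Qed.

Let ln_m_le : ln m%:R <= alpha * l.
Proof. by rewrite -[leRHS]expRK ler_ln ?posrE ?expR_gt0. Qed.

Let ln_m_ge : alpha * l - 1 <= ln m%:R.
Proof.
have : ln (expR (alpha * l)) <= ln (2 * m%:R).
  by rewrite ler_ln ?posrE ?expR_gt0// mulr_gt0.
by rewrite expRK lnM ?posrE//; move: ln2; lra.
Qed.

Let ln_ratio_le : ln (p%:R / s%:R) <= alpha * l + 1.
Proof.
have : ln (expR ((1 - alpha) * l)) <= ln (2 * s%:R).
  by rewrite ler_ln ?posrE ?expR_gt0// mulr_gt0.
rewrite expRK lnM ?posrE// ln_div ?posrE//.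
by move: ln2; rewrite -/l; lra.
Qed.

Let A_sqr : A ^+ 2 * n%:R = 2 * r * l.
Proof.
rewrite /A /amplitude sqr_sqrtr ?divfK ?gt_eqF//.
by rewrite divr_ge0// ?mulr_ge0// ltW.
Qed.

Let A_gt0 : 0 < A.
Proof. by rewrite sqrtr_gt0 divr_gt0// mulr_gt0// mulr_gt0. Qed.

Lemma minimax_risk_upper_rate (mu : probability (@design R n p) R) (delta : R) :
  0 <= delta <= 1 ->
  (minimax_risk mu s A <=
   (expR (s%:R * (3 - detection_rate * l)) +
    expR (s%:R * l * (3 / 2 * delta * (r - alpha) - detection_rate)))%:E +
   mu (~` near_isometry (delta / s%:R)))%E.
Proof.
move=> /andP[d0 d1].
(* With this weight the total mass (1 + 2 x)^p is at most e^(2 s), while x^(-s) = (p / s)^s plays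
   the role of the number of supports. *)
pose x : R := s%:R / p%:R.
have x0 : 0 < x by exact: divr_gt0.
(* To leading order, the log-likelihood ratio of the true pattern on data of amplitude kappa A. *)
pose c := tau * s%:R * l.
pose K := expR (- c) / x ^+ s.
have K0 : 0 <= K by rewrite divr_ge0 ?expR_ge0// exprn_ge0// ltW.
have Kx : K * x ^+ s = expR (- c) by rewrite divfK// expf_neq0// gt_eqF.
(* The optimal Chernoff parameter at delta = 0: it minimises 2 lam kappa^2 - 2 lam kappa + lam^2
   kappa^2. *)
pose lam := (1 - kappa) / kappa.
have lam0 : 0 <= lam by rewrite divr_ge0 ?subr_ge0 ?ltW.
have ds : delta / s%:R * s%:R = delta by rewrite divfK// gt_eqF.
have eta0 : 0 <= delta / s%:R by rewrite divr_ge0.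
have eta1 : delta / s%:R * s%:R <= 1 by rewrite ds.
have th0 : 0 <= kappa * A by rewrite mulr_ge0// ltW.
have := @minimax_risk_upper R n p s (kappa * A) x K A th0 (ltW x0) K0 mu c lam
  (delta / s%:R) lam0 eta0 eta1 Kx.
rewrite ds => /le_trans; apply.
rewrite EFinD -addeA leeD//; last first.
  rewrite leeD// lee_fin ler_expR.
  have lk : lam * kappa = 1 - kappa by rewrite divfK// gt_eqF.
  have -> : lam * (kappa * A) * n%:R * s%:R * A * (1 - delta) =
      (lam * kappa) * (A ^+ 2 * n%:R) * s%:R * (1 - delta) by ring.
  have -> : (lam + lam ^+ 2) * (kappa * A) ^+ 2 * n%:R * s%:R * (1 + delta) / 2 =
      (lam * kappa * kappa + (lam * kappa) ^+ 2) * (A ^+ 2 * n%:R) * s%:R * (1 + delta) / 2.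
    by ring.
  have -> : lam * c = lam * kappa * kappa * r * s%:R * l.
    by rewrite /c /tau; ring.
  (* With u = 1 - kappa, the exponent divided by s l is exactly r (3 delta u - u^2). *)
  rewrite A_sqr lk onem_kappaE /detection_rate /kappa.
  rewrite le_eqVlt; apply/orP; left; apply/eqP; field.
  exact: r_neq0.
rewrite lee_fin.
have xs : x ^+ s = expR (s%:R * ln x).
  by rewrite expRM_natl lnK.
have x2 : 1 + 2 * x <= expR (2 * x) by exact: expR_ge1Dx.
have xp : (1 + 2 * x) ^+ p <= expR (2 * s%:R).
  have -> : expR (2 * s%:R : R) = expR (2 * x) ^+ p.
    by rewrite -expRM_natl; congr expR; rewrite /x; field; rewrite gt_eqF.
  by rewrite lerXn2r ?nnegrE ?expR_ge0// addr_ge0// mulr_ge0// ltW.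
apply: (le_trans (ler_wpM2l K0 xp)).
rewrite /K xs -expRN -!expRD ler_expR.
have -> : - (s%:R * ln x) = s%:R * ln (p%:R / s%:R).
  by rewrite /x !ln_div ?posrE//; ring.
have := ler_wpM2l (ltW sR) ln_ratio_le.
by rewrite /c tauE; exact: type1_exponent.
Qed.

Let idx_lt (b : 'I_s) (k : 'I_m) : (b * m + k < p)%N.
Proof.
apply: leq_trans sm_le; apply: (@leq_trans (b.+1 * m)).
  by rewrite mulSn addnC ltn_add2r.
by rewrite leq_mul2r ltn_ord orbT.
Qed.

Let idx (b : 'I_s) (k : 'I_m) : 'I_p := Ordinal (idx_lt b k).

Let idx_inj b k b' k' : idx b k = idx b' k' -> b = b' /\ k = k'.
Proof.
move=> /(congr1 val)/= E; split; apply/val_inj => /=.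
  have := congr1 (divn^~ m) E; rewrite /= !divnMDl ?m0// !divn_small ?ltn_ord//.
  by rewrite !addn0.
by have := congr1 (modn^~ m) E; rewrite /= !modnMDl !modn_small ?ltn_ord.
Qed.

Lemma minimax_risk_lower_rate (mu : probability (@design R n p) R) (delta : R) :
  0 <= delta <= 1 ->
  ((expR (- (s%:R * (l * (detection_rate + 8 * delta * r) + 2 +
      4 * expR (1 / 2) * Num.sqrt (4 * r * l)))))%:E *
    mu (near_isometry (delta / s%:R)) <= minimax_risk mu s A)%E.
Proof.
move=> /andP[d0 d1].
have ds : delta / s%:R * s%:R = delta by rewrite divfK// gt_eqF.
have eta0 : 0 <= delta / s%:R by rewrite divr_ge0.
(* At this kappa the drift A^2 n s (kappa - 1/2) equals alpha s l and cancels s log m; only its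
   delta error remains. *)
pose c1 := s%:R * (delta * alpha * l).
(* From theta^2 n = 2 tau l and tau - alpha equal to the rate; the final 1 pays for the truncation
   of m. *)
pose c2 := l * (detection_rate + 3 * delta * tau) + 1.
have th : (kappa * A) ^+ 2 * n%:R = 2 * tau * l.
  have -> : (kappa * A) ^+ 2 * n%:R = kappa ^+ 2 * (A ^+ 2 * n%:R) by ring.
  by rewrite A_sqr /tau; ring.
have c10 : 0 <= c1.
  apply: mulr_ge0; first exact: ltW.
  by apply: mulr_ge0; [apply: mulr_ge0 => //; exact: ltW|exact: ltW].
have c20 : 0 <= c2.
  rewrite addr_ge0//; apply: mulr_ge0; first exact: ltW.
  rewrite addr_ge0 ?detection_rate_ge0//.
  by apply: mulr_ge0; [exact: mulr_ge0|exact: ltW].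
have c1_ge : s%:R * ln m%:R - A ^+ 2 * n%:R * s%:R *
    (1 - delta / s%:R * s%:R) * (kappa - 1 / 2) <= c1.
  rewrite ds A_sqr kappa_halfE.
  have -> : 2 * r * l * s%:R * (1 - delta) * (alpha / (2 * r)) =
    s%:R * (l * alpha * (1 - delta)) by field.
  by have := ler_wpM2l (ltW sR) ln_m_le; rewrite /c1; lra.
have c2_ge : (kappa * A) ^+ 2 * n%:R * (1 / 2 + 3 / 2 * (delta / s%:R * s%:R)) -
    ln m%:R <= c2.
  by rewrite ds th /c2; have := ln_m_ge; rewrite tauE; lra.
have := minimax_risk_lower idx_inj eta0 n0 sparsity_gt0 m0 A_gt0 kappa_half
  c1_ge c10 c20 c2_ge mu.
apply: le_trans; apply: lee_wpmul2r; first exact: measure_ge0.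
rewrite lee_fin ler_expR lerN2 /fixed_exponent ds.
(* The left side only grows like sqrt s; weakening it to s puts it in the same form as the s block
   terms. *)
have W1 : Num.sqrt (A ^+ 2 * (n%:R * s%:R * (1 + delta))) <=
    s%:R * Num.sqrt (4 * r * l).
  have -> : s%:R * Num.sqrt (4 * r * l) = Num.sqrt (s%:R ^+ 2 * (4 * r * l)).
    by rewrite [RHS]sqrtrM ?sqr_ge0// sqrtr_sqr ger0_norm// ltW.
  rewrite ler_wsqrtr//.
  have -> : A ^+ 2 * (n%:R * s%:R * (1 + delta)) = s%:R * (A ^+ 2 * n%:R * (1 + delta)).
    by ring.
  have -> : s%:R ^+ 2 * (4 * r * l) = s%:R * (s%:R * (4 * r * l)) by ring.
  rewrite A_sqr; apply: ler_wpM2l; first exact: ltW.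
  have rl : 0 <= 2 * r * l.
    by apply: mulr_ge0; [apply: mulr_ge0 => //; exact: ltW|exact: ltW].
  apply: (@le_trans _ _ (4 * r * l)).
    by have := ler_wpM2l rl d1; lra.
  by rewrite ler_peMl//; lra.
have W2 : Num.sqrt ((kappa * A) ^+ 2 * (n%:R * (1 + delta))) <= Num.sqrt (4 * r * l).
  rewrite ler_wsqrtr// mulrA th.
  have tl : 0 <= 2 * tau * l.
    by apply: mulr_ge0; [apply: mulr_ge0 => //; exact: ltW|exact: ltW].
  have h1 := ler_wpM2l tl d1; have h2 := ler_wpM2r (ltW l0) tau_le.
  by lra.
have e0 : 0 <= 2 * expR (1 / 2) :> R by rewrite mulr_ge0 ?expR_ge0.
have W1' := ler_wpM2l e0 W1.
have W2' := ler_wpM2l (ltW sR) (ler_wpM2l e0 W2).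
have th2 : 2 * delta * (kappa * A) ^+ 2 * n%:R = 4 * delta * tau * l.
  have -> : 2 * delta * (kappa * A) ^+ 2 * n%:R = 2 * delta * ((kappa * A) ^+ 2 * n%:R).
    by ring.
  by rewrite th; ring.
rewrite th2 /c1 /c2.
have dl : 0 <= s%:R * (delta * l).
  by apply: mulr_ge0; [exact: ltW|apply: mulr_ge0 => //; exact: ltW].
have at_r : alpha + 7 * tau <= 8 * r by move: tau_le alpha_r; lra.
exact: lower_exponent (ler_wpM2l dl at_r) W1' W2'.
Qed.

End fixed_size.
End rates.

Lemma lower_rate_arith {R : realType} (S L D d r e Q : R) :
  S * Q <= S * (L * e / 4) -> S * 12 <= S * (L * e) ->
  S * L * (8 * d * r) <= S * L * (e / 4) -> 1 <= S ->
  S * (L * (D + 8 * d * r) + 2 + Q) + 1 <= S * L * (D + e).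
Proof. lra. Qed.

Lemma subG_rate_arith {R : realType} (rho S L q X Y : R) :
  X <= Y -> (rho + 3) * L * q <= X -> rho * (S * L) <= rho * (q * L) ->
  L <= L * q -> 1 <= L -> 1 + 2 * L - Y <= - (rho * (S * L)).
Proof. lra. Qed.

Section log_risk.
Context {R : realType}.
Variables alpha r : R.
Hypotheses (alpha_half : 1 / 2 < alpha) (alpha1 : alpha < 1) (alpha_r : alpha < r).
Notation rho := (detection_rate alpha r).

Lemma detection_rate_gt0 : 0 < rho.
Proof.
by rewrite divr_gt0 ?exprn_gt0 ?subr_gt0// mulr_gt0//; move: alpha_half alpha_r; lra.
Qed.

Section fixed_size.
Variables (n p : nat) (mu : probability (@design R n p) R) (delta eps : R).
Let l : R := ln p%:R.
Let s := sparsity alpha p.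
Let risk := minimax_risk mu s (amplitude r n p).
Hypotheses (n0 : (0 < n)%N) (l1 : 1 <= l) (delta01 : 0 <= delta <= 1).
(** The one property through which either design class enters: the upper bound adds this probability
    to the risk, so it must not exceed the target. *)
Hypothesis design_bound :
  (mu (~` near_isometry (delta / s%:R)) <= (expR (- (rho * (s%:R * l))))%:E)%E.

Let s1 : (1 : R) <= s%:R.
Proof. by rewrite ler1n; exact: sparsity_gt0. Qed.

Let sl_ge : l <= s%:R * l.
Proof. by rewrite ler_peMl//; apply: le_trans l1. Qed.

Let sl_gt0 : 0 < s%:R * l.
Proof. by apply: lt_le_trans sl_ge; exact: lt_le_trans l1. Qed.

Lemma log_risk_upper : 0 < eps -> 12 / eps <= l ->
  3 / 2 * delta * (r - alpha) <= eps / 2 ->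
  (risk <= (expR (s%:R * l * (eps - rho)))%:E)%E.
Proof.
move=> eps0 l_eps d_eps.
have le12 : 12 <= l * eps by rewrite -ler_pdivrMr.
have := minimax_risk_upper_rate alpha_half alpha1 alpha_r n0 l1 mu delta01.
move=> /le_trans; apply.
apply: (le_trans (leeD2l _ design_bound)).
rewrite -EFinD lee_fin.
set E := expR (s%:R * l * (eps / 2 - rho)).
have sle : 12 <= s%:R * l * eps.
  by apply: (le_trans le12); rewrite ler_wpM2r// ltW.
have s0 : 0 <= s%:R :> R by exact: ler0n.
have sl0 := ltW sl_gt0.
have b1 : expR (s%:R * (3 - rho * l)) <= E.
  rewrite ler_expR; have := ler_wpM2l s0 le12; lra.
have b2 : expR (s%:R * l * (3 / 2 * delta * (r - alpha) - rho)) <= E.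
  by rewrite ler_expR ler_wpM2l// lerD2r.
have b3 : expR (- (rho * (s%:R * l))) <= E.
  rewrite ler_expR; move: sle; lra.
have E0 : 0 <= E by exact: expR_ge0.
have e2 : 3 <= expR 2 :> R by have := expR_ge1Dx (2 : R); lra.
(* Three terms at accuracy eps / 2 merge into one at accuracy eps, because 3 <= e^2 and s l eps / 2
   >= 6. *)
apply: (@le_trans _ _ (E * expR 2)).
  have := ler_wpM2l E0 e2; move: b1 b2 b3; lra.
by rewrite -expRD ler_expR; move: sle; lra.
Qed.

Lemma log_risk_lower : 0 < eps -> 12 / eps <= l -> rho^-1 <= l ->
  8 * delta * r <= eps / 4 ->
  4 * r <= (eps / (16 * expR (1 / 2))) ^+ 2 * l ->
  ((expR (- (s%:R * l * (rho + eps))))%:E <= risk)%E.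
Proof.
move=> eps0 l_eps l_rho d_eps l_sqrt.
have le12 : 12 <= l * eps by rewrite -ler_pdivrMr.
have l0 : 0 <= l by apply: le_trans l1.
have s0 : 0 <= s%:R :> R by exact: ler0n.
have := minimax_risk_lower_rate alpha_half alpha1 alpha_r n0 l1 mu delta01.
apply: le_trans.
set x := s%:R * (l * _ + 2 + _).
have mG := @measurable_near_isometry R n p (delta / s%:R).
(* Good designs keep at least half of the mass, which costs one unit in the exponent. *)
have half : ((expR (- 1))%:E <= mu (near_isometry (delta / s%:R)))%E.
  have e1 : 2 <= expR 1 :> R by have := expR_ge1Dx (1 : R); lra.
  have em1 : expR (- 1) <= 1 / 2 :> R.
    by rewrite expRN -[leLHS]mul1r ler_pdivrMr ?expR_gt0//; lra.
  have small : (mu (~` near_isometry (delta / s%:R)) <= (expR (- 1))%:E)%E.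
    apply: (le_trans design_bound); rewrite lee_fin ler_expR lerN2.
    have : rho^-1 <= s%:R * l by apply: le_trans sl_ge.
    move=> /(ler_wpM2l (ltW detection_rate_gt0)).
    by rewrite mulfV// gt_eqF// detection_rate_gt0.
  have := probability_setC mu mG.
  have fG : (mu (near_isometry (delta / s%:R)) \is a fin_num)%E by exact: fin_num_measure.
  move: small => /[swap] -> ; rewrite -(fineK fG) -EFinB !lee_fin.
  by lra.
have e0 : (0 <= (expR (- x))%:E)%E by rewrite lee_fin expR_ge0.
apply: le_trans (lee_wpmul2l e0 half).
rewrite -EFinM -expRD lee_fin ler_expR -opprD lerN2.
(* The fluctuations are of order sqrt l, hence within a share eps l / 4 of the budget for large
   l. *)
have sq : 4 * expR (1 / 2) * Num.sqrt (4 * r * l) <= l * eps / 4.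
  have e12 : 0 < 16 * expR (1 / 2) :> R by rewrite mulr_gt0 ?expR_gt0.
  have h0 : 0 <= eps / (16 * expR (1 / 2)) * l.
    by apply: mulr_ge0 => //; apply: divr_ge0; exact: ltW.
  have : Num.sqrt (4 * r * l) <= eps / (16 * expR (1 / 2)) * l.
    rewrite -[leRHS]ger0_norm// -sqrtr_sqr ler_wsqrtr// exprMn expr2 mulrA.
    rewrite -[in leRHS](mulrA _ l l) [l * l]mulrC.
    have := ler_wpM2r l0 l_sqrt; lra.
  move=> /(ler_wpM2l (ltW e12)).
  have -> : 16 * expR (1 / 2) * (eps / (16 * expR (1 / 2)) * l) = eps * l.
    by field; rewrite gt_eqF// expR_gt0.
  lra.
have slc := ler_wpM2l s0 sq.
have sle := ler_wpM2l s0 le12.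
have sld := ler_wpM2l (ltW sl_gt0) d_eps.
rewrite /x; move: slc sle sld s1.
set Q := 4 * expR (1 / 2) * _.
exact: lower_rate_arith.
Qed.

Lemma log_risk_dist : 0 < eps -> 12 / eps <= l -> rho^-1 <= l ->
  8 * delta * r <= eps / 4 -> 3 / 2 * delta * (r - alpha) <= eps / 2 ->
  4 * r <= (eps / (16 * expR (1 / 2))) ^+ 2 * l ->
  `|- rho - ln (fine risk) / (s%:R * l)| <= eps.
Proof.
move=> eps0 h1 h2 h3 h4 h5.
have U := log_risk_upper eps0 h1 h4.
have L := log_risk_lower eps0 h1 h2 h3 h5.
(* The two bounds make the risk finite and positive, so neither [fine] nor [ln] takes a default
   value here. *)
have F : risk \is a fin_num.
  rewrite fin_numE; apply/andP; split.
    by apply/eqP => E; move: L; rewrite E leeNy_eq.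
  by apply/eqP => E; move: U; rewrite E leye_eq.
move: U L; rewrite -(fineK F) !lee_fin => U L.
have P0 : 0 < fine risk by exact: lt_le_trans (expR_gt0 _) L.
have U' : ln (fine risk) <= s%:R * l * (eps - rho).
  by rewrite -[leRHS]expRK ler_ln ?posrE ?expR_gt0.
have L' : - (s%:R * l * (rho + eps)) <= ln (fine risk).
  by rewrite -[leLHS]expRK ler_ln ?posrE ?expR_gt0.
have U2 : ln (fine risk) / (s%:R * l) <= eps - rho by rewrite ler_pdivrMr// mulrC.
have L2 : - (rho + eps) <= ln (fine risk) / (s%:R * l).
  by rewrite ler_pdivlMr// mulrC mulrN.
by rewrite ler_norml; move: U2 L2; set z := ln _ / _; lra.
Qed.

End fixed_size.

(** Let q = sqrt p and D = delta^2 / (4 C). As alpha > 1/2, s <= q, so n / s^2 >= q^2: the deviation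
    exponent is at least D p, while the target is at most rho q log p. *)
Lemma subG_deviation_small (n p : nat) (C delta : R) :
  0 < C -> 0 < delta -> 1 <= ln p%:R :> R ->
  16 * (rho + 3) / (delta ^+ 2 / (4 * C)) <= ln p%:R ->
  p%:R ^+ 2 <= n%:R :> R ->
  2 * p%:R ^+ 2 * expR (- (n%:R * (delta / (sparsity alpha p)%:R) ^+ 2 / (4 * C))) <=
  expR (- (rho * ((sparsity alpha p)%:R * ln p%:R))).
Proof.
move=> C0 d0; set l := ln p%:R; set s := sparsity alpha p => l1 lD pn.
have l0 : 0 < l by exact: lt_le_trans l1.
have p0 : (0 : R) < p%:R.
  rewrite ltr0n lt0n; apply/eqP => p0; move: l0; rewrite /l p0 ln0//.
  by rewrite ltxx.
have pE : p%:R = expR l :> R by rewrite lnK// posrE.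
set D := delta ^+ 2 / (4 * C) in lD *.
have D0 : 0 < D by rewrite divr_gt0 ?exprn_gt0 ?mulr_gt0.
have s0 : (0 : R) < s%:R by rewrite ltr0n; exact: sparsity_gt0.
set q := expR (l / 2).
have q0 : 0 < q by exact: expR_gt0.
have s_le : s%:R <= q.
  apply: (le_trans (sparsity_le alpha1 l1)).
  rewrite ler_expR mulrC; apply: ler_wpM2l; first exact: ltW.
  by move: alpha_half; lra.
have s_le2 : s%:R ^+ 2 <= expR (2 * (1 - alpha) * l).
  have -> : expR (2 * (1 - alpha) * l) = expR ((1 - alpha) * l) ^+ 2.
    by rewrite -expRM_natl; congr expR; ring.
  rewrite lerXn2r ?nnegrE ?expR_ge0 ?ler0n//.
  exact: (sparsity_le alpha1 l1).
have dev : D * q ^+ 2 <= n%:R * (delta / s%:R) ^+ 2 / (4 * C).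
  have -> : n%:R * (delta / s%:R) ^+ 2 / (4 * C) = D * (n%:R / s%:R ^+ 2).
    by rewrite /D; field; rewrite !gt_eqF.
  rewrite ler_wpM2l ?(ltW D0)// ler_pdivlMr ?exprn_gt0//.
  apply: le_trans pn; rewrite pE.
  apply: (@le_trans _ _ (q ^+ 2 * expR (2 * (1 - alpha) * l))).
    by rewrite ler_wpM2l// sqr_ge0.
  rewrite /q -!expRM_natl -expRD ler_expR.
  have : 0 <= l * (2 * alpha - 1).
    by apply: mulr_ge0; [exact: ltW|move: alpha_half; lra].
  by lra.
(* Makes D q exceed (rho + 3) l as soon as l >= 16 (rho + 3) / D; the 3 covers the prefactor 2 p^2
   <= e^(1 + 2 l). *)
have ql : l ^+ 2 / 16 <= q.
  have l20 : 0 <= l / 2 by rewrite divr_ge0// ltW.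
  by have := sqr_le_expR l20; rewrite -/q; lra.
have q1 : 1 <= q by rewrite -expR0 ler_expR divr_ge0// ltW.
have lD' : 16 * (rho + 3) <= l * D by rewrite -ler_pdivrMr.
have Dq : (rho + 3) * l <= D * q.
  apply: (@le_trans _ _ (D * (l ^+ 2 / 16))); last by rewrite ler_wpM2l// ltW.
  have := ler_wpM2r (ltW l0) lD'; lra.
have Dq2 : (rho + 3) * l * q <= D * q ^+ 2.
  by rewrite expr2 mulrA ler_wpM2r// ltW.
have e1 : 2 <= expR 1 :> R by have := expR_ge1Dx (1 : R); lra.
have sl : rho * (s%:R * l) <= rho * (q * l).
  by rewrite ler_wpM2l ?(ltW detection_rate_gt0)// ler_wpM2r// ltW.
have lq : l <= l * q by rewrite ler_peMr// ltW.
have -> : 2 * p%:R ^+ 2 = 2 * expR (2 * l).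
  by rewrite pE -expRM_natl.
apply: (@le_trans _ _ (expR 1 * expR (2 * l) *
   expR (- (n%:R * (delta / s%:R) ^+ 2 / (4 * C))))).
  by rewrite ler_wpM2r ?expR_ge0// ler_wpM2r ?expR_ge0.
rewrite -!expRD ler_expR.
by move: dev Dq2 sl lq l1; apply: subG_rate_arith.
Qed.

End log_risk.

(** * Passage to the limit *)

Section eventually.
Context {R : realType}.

Lemma near_ln_ge (M : R) : \forall p \near \oo, M <= ln (p%:R : R).
Proof.
near=> p.
have pM : expR M <= p%:R by near: p; exact: nbhs_infty_ger.
by rewrite -[leLHS]expRK ler_ln ?posrE ?expR_gt0// (lt_le_trans (expR_gt0 M)).
Unshelve. all: by end_near. Qed.

Variables (alpha r sigma2 : R) (n : nat -> nat).
Variable mu : forall p : nat, probability (@design R (n p) p) R.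
Hypotheses (alpha_half : 1 / 2 < alpha) (alpha1 : alpha < 1) (alpha_r : alpha < r).
Notation rho := (detection_rate alpha r).

Definition design_regime :=
  (exists nu : forall p : nat, probability (p.-tuple R) R,
      [/\ forall p, rows_iid (mu p) (nu p),
          forall p, centered_isotropic_subG sigma2 (nu p),
          forall p, {ae mu p, forall X, posdef (XtX X)} &
          ((fun p => (n p)%:R / p%:R ^+ 2 : R) @ \oo --> +oo)])
   \/
   ((forall p, (p <= n p)%N) /\
    (forall p, {ae mu p, forall X, XtX X = (n p)%:R%:M})).

Lemma near_design_bound (delta : R) : 0 < delta <= 1 -> design_regime ->
  \forall p \near \oo,
    (mu p (~` near_isometry (delta / (sparsity alpha p)%:R)) <=
     (expR (- (rho * ((sparsity alpha p)%:R * ln p%:R))))%:E)%E.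
Proof.
move=> /andP[d0 d1] [[nu [iid_mu subg _ ndiv]]|[_ orth]]; last first.
  near=> p; rewrite near_isometry_orthogonal ?lee_fin ?expR_ge0//.
  by rewrite divr_ge0// ltW.
near=> p.
have C0 := covariance_rate_gt0 sigma2.
have l1 : 1 <= ln (p%:R : R) by near: p; exact: near_ln_ge.
have lD : 16 * (rho + 3) / (delta ^+ 2 / (4 * covariance_rate sigma2)) <= ln p%:R.
  by near: p; exact: near_ln_ge.
have n_ge : 1 <= (n p)%:R / p%:R ^+ 2 :> R by near: p; move/cvgryPge : ndiv; apply.
have p0 : (0 : R) < p%:R.
  by rewrite ltr0n lt0n; apply/eqP => p0; move: l1; rewrite p0 ln0// ler10.
have pn : p%:R ^+ 2 <= (n p)%:R :> R.
  by move: n_ge; rewrite ler_pdivlMr ?exprn_gt0// mul1r.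
have s0 := sparsity_gt0 alpha1 l1.
have eta01 : 0 <= delta / (sparsity alpha p)%:R <= 1.
  rewrite divr_ge0 ?(ltW d0)//= ler_pdivrMr ?ltr0n// mul1r.
  by apply: (le_trans d1); rewrite ler1n.
apply: (le_trans (near_isometry_subG (iid_mu p) (subg p) eta01)); rewrite lee_fin.
exact: subG_deviation_small.
Unshelve. all: by end_near. Qed.

End eventually.

Theorem mainTheorem5 (R : realType) (alpha r sigma2 : R) (n : nat -> nat)
  (mu : forall p : nat, probability (@design R (n p) p) R) :
  1 / 2 < alpha < 1 -> alpha < r ->
  ((fun p => (n p)%:R : R) @ \oo --> +oo) ->
  ((exists nu : forall p : nat, probability (p.-tuple R) R,
      [/\ forall p, rows_iid (mu p) (nu p),
          forall p, centered_isotropic_subG sigma2 (nu p),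
          forall p, {ae mu p, forall X, posdef (XtX X)} &
          ((fun p => (n p)%:R / p%:R ^+ 2 : R) @ \oo --> +oo)])
   \/
   ((forall p, (p <= n p)%N) /\
    (forall p, {ae mu p, forall X, XtX X = (n p)%:R%:M}))) ->
  (fun p => ln (fine (minimax_risk (mu p) (sparsity alpha p) (amplitude r (n p) p)))
            / ((sparsity alpha p)%:R * ln p%:R))
    @ \oo --> - (r - alpha) ^+ 2 / (4 * r).
Proof.
move=> /andP[alpha_half alpha1] alpha_r n_oo regime.
have r0 : 0 < r by lra.
rewrite mulNr -/(detection_rate alpha r).
apply/cvgrPdist_le => eps eps0.
(* Small enough for both error budgets, 8 delta r <= eps / 4 and 3/2 delta (r - alpha) <= eps / 2;
   the minimum with 1 is the range in which the finite-size bounds hold. *)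
pose delta := Num.min 1 (eps / (32 * r)).
have d0 : 0 < delta by rewrite lt_min ltr01 divr_gt0// mulr_gt0.
have d1 : delta <= 1 by rewrite ge_min lexx.
have d01 : 0 < delta <= 1 by rewrite d0 d1.
have dr : delta * r <= eps / 32.
  have -> : eps / 32 = eps / (32 * r) * r by field; rewrite gt_eqF.
  by rewrite ler_wpM2r ?(ltW r0)// ge_min lexx orbT.
have da : 0 <= delta * alpha by rewrite mulr_ge0 ?(ltW d0)//; lra.
near=> p.
apply: (@log_risk_dist _ _ _ alpha_half alpha1 alpha_r _ _ _ delta).
- have : 1 <= (n p)%:R :> R by near: p; move/cvgryPge : n_oo; apply.
  by rewrite ler1n.
- by near: p; exact: near_ln_ge.
- by rewrite (ltW d0).
- by near: p; exact: (near_design_bound alpha_half alpha1 alpha_r d01 regime).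
- exact: eps0.
- by near: p; exact: near_ln_ge.
- by near: p; exact: near_ln_ge.
- by lra.
- by lra.
- have e0 : 0 < (eps / (16 * expR (1 / 2))) ^+ 2.
    by rewrite exprn_gt0// divr_gt0// mulr_gt0// expR_gt0.
  rewrite [leRHS]mulrC -ler_pdivrMr//.
  by near: p; exact: near_ln_ge.
Unshelve. all: by end_near. Qed.
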